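(* For integers $n,r\ge0$, $$\frac{1}{r!\,n!}\int_{E_2}\left(\log\frac{1-t_1}{1-t_2}\right)^r\left(\log\frac{1}{1-t_1}-\log\frac{t_2}{t_1}\right)^n\frac{dt_1\,dt_2}{(1-t_1)t_2}=\begin{cases}\zeta^\star(r+2,\{2\}^m),& n=2m,\\ 0,& n=2m+1.\end{cases}$$
   Context: $E_2=\{(t_1,t_2)\in\mathbb{R}^2:0<t_1<t_2<1\}$. $\zeta^\star(\alpha_1,\ldots,\alpha_s)=\sum_{1\le k_1\le\cdots\le k_s}k_1^{-\alpha_1}\cdots k_s^{-\alpha_s}$; $(r+2,\{2\}^m)$ denotes $r+2$ followed by $m$ copies of $2$. *)

(* Defs.v *)
From HB Require Import structures.
From mathcomp Require Import all_boot all_order all_algebra.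
From mathcomp Require Import all_classical all_reals all_analysis.
Set Implicit Arguments. Unset Strict Implicit. Unset Printing Implicit Defensive.
Import Order.TTheory GRing.Theory Num.Theory.
Import numFieldNormedType.Exports.
Local Open Scope classical_set_scope.
Local Open Scope ring_scope.

Fixpoint zst {R : realType} (s : seq nat) (lo N : nat) : R :=
  match s with
  | [::] => 1
  | a :: s' => \sum_(lo <= k < N.+1) ((k%:R : R) ^- a) * zst s' k N
  end.

Definition zeta_star {R : realType} (s : seq nat) : R :=
  lim ((fun N : nat => zst s 1 N) @ \oo).

Definition E2 {R : realType} : set (R * R) :=
  [set t | 0 < t.1 /\ t.1 < t.2 /\ t.2 < 1].

Definition integrand3p2 {R : realType} (r n : nat) (t : R * R) : R :=
  (ln ((1 - t.1) / (1 - t.2))) ^+ r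
  * (ln (1 / (1 - t.1)) - ln (t.2 / t.1)) ^+ n
  / ((1 - t.1) * t.2).

(* Main.v *)
(* Put a = 1 - t1 and b = (1 - t2) / (1 - t1).  For fixed b the substitution
   p = t1 / (1 - a^2 b) turns t1 / ((1 - t1) t2) into p / (1 - p), and the
   Jacobian, divided by t2, becomes a function of b p (1 - p) alone, namely
   sum_k C(2k+2, k+1) / 2 (b p (1 - p))^k.  By Tonelli the integral of
   log(..)^r h(..) therefore equals, for every continuous h >= 0,
     sum_k C(2k+2, k+1) / 2 * r! / (k+1)^(r+1)
           * int_0^1 h(log (p / (1 - p))) (p (1 - p))^k dp.
   The symmetry p -> 1 - p kills odd powers.  For even powers, integration by
   parts shows that the normalized moments D m k of the logit under the
   Beta(k, k) distribution satisfy D (m+1) k - D (m+1) (k+1) = D m k / k^2;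
   as they vanish when k tends to infinity, D m k is the tail
   sum_{k <= k_1 <= .. <= k_m} 1 / (k_1^2 .. k_m^2). *)
Require Import Defs.
From HB Require Import structures.
From mathcomp Require Import all_boot all_order all_algebra.
From mathcomp Require Import all_classical all_reals all_analysis.
From mathcomp Require Import measurable_realfun ring lra.
Import Order.TTheory GRing.Theory Num.Theory.
Import numFieldNormedType.Exports.
Local Open Scope classical_set_scope.
Local Open Scope ring_scope.

Set Implicit Arguments.
Unset Strict Implicit.

(** * Integrals over open intervals *)

(** The logarithms are unbounded on [E2] and odd powers change sign. Hence the transformations are
    carried out for nonnegative continuous h, with values in the extended reals, where Tonelli and
    monotone convergence ask for no finiteness. Integrability is read off afterwards from the finite
    value found for even powers. An odd power is the difference of two nonnegative functions
    exchanged by y -> - y, whose integrals are finite by comparison with 1 + y^(2n).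

    The binomial coefficients come from u = a b p: here u (1 - u) = b p (1 - p) and 1 / t2 = (dp /
    dt1) / ((1 - 2u) (1 - u)). The series of C(2k, k) x^k at x = u (1 - u) is 1 / (1 - 2u); removing
    its constant term and dividing by 2x gives 1 / ((1 - 2u) (1 - u)). The factor r! / (k+1)^(r+1)
    is the integral of (- log b)^r b^k.

    The moments vanish at infinity because the squared logit, times (p (1 - p))^2, is at most 1 - 4
    p (1 - p), while the ratio of consecutive normalizing constants tends to 4. *)

Lemma measurable_fun_continuous_oo {R : realType} (f : R -> R) (a b : R) :
  {in `]a, b[, continuous f} -> measurable_fun `]a, b[ f.
Proof.
move=> cf; apply: open_continuous_measurable_fun; first exact: interval_open.
by move=> x; rewrite inE => xab; exact: cf.
Qed.

(** Monotone convergence along an exhaustion by compact intervals. It carries the fundamental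
    theorem and the change of variables over to open intervals at whose ends the integrand may blow
    up. *)
Lemma cvg_integral_cc_oo {R : realType} (f : R -> R) (a b : R) (u v : R^nat) :
  {in `]a, b[, continuous f} -> {in `]a, b[, forall x, 0 <= f x} ->
  (forall n, a < u n) -> (forall n, v n < b) ->
  nonincreasing_seq u -> nondecreasing_seq v ->
  u @ \oo --> a -> v @ \oo --> b ->
  (\int[lebesgue_measure]_(x in `[u n, v n]) (f x)%:E)%E @[n --> \oo] -->
  (\int[lebesgue_measure]_(x in `]a, b[) (f x)%:E)%E.
Proof.
move=> cf f0 au vb ndu ndv ua vb'.
have sub n : `[u n, v n]%classic `<=` `]a, b[%classic.
  move=> x /=; rewrite !in_itv/= => /andP[ux xv].
  by rewrite (lt_le_trans (au n) ux) (le_lt_trans xv (vb n)).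
have -> : `]a, b[%classic = \bigcup_n `[u n, v n]%classic.
  apply/seteqP; split => [x /=|x [n _] /sub//].
  rewrite in_itv/= => /andP[ax xb].
  have : \forall n \near \oo, u n <= x /\ x <= v n.
    near=> n; split.
      by apply/ltW; near: n; exact: (cvgr_lt a).
    by apply/ltW; near: n; exact: (cvgr_gt b).
  move=> [N _ /(_ N (leqnn _))[? ?]]; exists N => //=.
  by rewrite in_itv/=; apply/andP.
apply: ge0_nondecreasing_set_cvg_integral => //.
- move=> m n mn; rewrite subsetEset => x /=; rewrite !in_itv/= => /andP[ux xv].
  by rewrite (le_trans (ndu _ _ mn) ux) (le_trans xv (ndv _ _ mn)).
- move=> n; apply/measurable_EFinP.
  by apply: (measurable_funS _ (sub n) (measurable_fun_continuous_oo cf)).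
- by move=> n x /sub xab; rewrite lee_fin f0.
Unshelve. all: end_near. Qed.

(** The offset 3 keeps [loseq] below [hiseq] already at index 0, since each end moves by at most a
    third of the length. *)
Definition loseq {R : realType} (a b : R) (n : nat) : R := a + (b - a) / n.+3%:R.
Definition hiseq {R : realType} (a b : R) (n : nat) : R := b - (b - a) / n.+3%:R.

Lemma loseq_hiseqP {R : realType} (a b : R) : a < b ->
  [/\ forall n, a < loseq a b n, forall n, hiseq a b n < b,
      forall n, loseq a b n < hiseq a b n,
      nonincreasing_seq (loseq a b) & nondecreasing_seq (hiseq a b)].
Proof.
move=> ab; have ba : 0 < b - a by rewrite subr_gt0.
have h n : 0 < (n.+3%:R : R)^-1 by rewrite invr_gt0.
have hd m n : (m <= n)%N -> (n.+3%:R : R)^-1 <= m.+3%:R^-1.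
  by move=> mn; rewrite lef_pV2 ?posrE// ler_nat.
have h3 n : (n.+3%:R : R)^-1 <= 3^-1 by rewrite (hd 0%N).
split.
- by move=> n; rewrite /loseq ltrDl mulr_gt0.
- by move=> n; rewrite /hiseq ltrBlDr ltrDl mulr_gt0.
- move=> n; rewrite /loseq /hiseq.
  have : (b - a) / n.+3%:R <= (b - a) / 3 by rewrite ler_pM2l.
  by move: (_ / n.+3%:R) => c; lra.
- by move=> m n mn; rewrite /loseq lerD2l ler_pM2l ?hd.
- by move=> m n mn; rewrite /hiseq lerD2l lerN2 ler_pM2l ?hd.
Qed.

Lemma cvg_inv_natS3 {R : realType} : (n.+3%:R : R)^-1 @[n --> \oo] --> (0:R).
Proof.
have := @cvg_harmonic R; rewrite -cvg_shiftS -cvg_shiftS.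
exact.
Qed.

Lemma cvg_loseq {R : realType} (a b : R) : loseq a b @ \oo --> a.
Proof.
rewrite -[X in _ --> X]addr0 -[X in _ + X](mulr0 (b - a)).
by apply: cvgD; [exact: cvg_cst | apply: cvgM; [exact: cvg_cst|exact: cvg_inv_natS3]].
Qed.

Lemma cvg_hiseq {R : realType} (a b : R) : hiseq a b @ \oo --> b.
Proof.
rewrite -[X in _ --> X]subr0 -[X in _ - X](mulr0 (b - a)).
by apply: cvgB; [exact: cvg_cst | apply: cvgM; [exact: cvg_cst|exact: cvg_inv_natS3]].
Qed.

Lemma cvg_loseq_comp {R : realType} (F : R -> R) (a b l : R) : a < b ->
  F x @[x --> a^'+] --> l -> F (loseq a b n) @[n --> \oo] --> l.
Proof.
move=> ab Fl; have [alo _ _ _ _] := loseq_hiseqP ab.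
by move/cvg_at_rightP: Fl; apply; split => //; exact: cvg_loseq.
Qed.

Lemma cvg_hiseq_comp {R : realType} (F : R -> R) (a b l : R) : a < b ->
  F x @[x --> b^'-] --> l -> F (hiseq a b n) @[n --> \oo] --> l.
Proof.
move=> ab Fl; have [_ hib _ _ _] := loseq_hiseqP ab.
by move/cvg_at_leftP: Fl; apply; split => //; exact: cvg_hiseq.
Qed.

Lemma cvg_integral_lohi {R : realType} (f : R -> R) (a b : R) : a < b ->
  {in `]a, b[, continuous f} -> {in `]a, b[, forall x, 0 <= f x} ->
  (\int[lebesgue_measure]_(x in `[loseq a b n, hiseq a b n]) (f x)%:E)%E
    @[n --> \oo] --> (\int[lebesgue_measure]_(x in `]a, b[) (f x)%:E)%E.
Proof.
move=> ab cf f0; have [alo hib _ dlo dhi] := loseq_hiseqP ab.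
by apply: cvg_integral_cc_oo => //; [exact: cvg_loseq | exact: cvg_hiseq].
Qed.

Lemma derivable_oo_LRcontinuous_sub {R : realType} (F : R -> R) (a b u v : R) :
  {in `]a, b[, forall x : R, derivable F x 1} -> a < u -> u < v -> v < b ->
  derivable_oo_LRcontinuous F u v.
Proof.
move=> dF au uv vb.
have cF x : x \in `]a, b[ -> {for x, continuous F}.
  by move=> /dF/derivable1_diffP/differentiable_continuous.
split.
- move=> x; rewrite in_itv/= => /andP[ux xv]; apply: dF.
  by rewrite in_itv/= (lt_trans au ux) (lt_trans xv vb).
- by apply/cvg_at_right_filter/cF; rewrite in_itv/= au (lt_trans uv vb).
- by apply/cvg_at_left_filter/cF; rewrite in_itv/= vb (lt_trans au uv).
Qed.

Lemma within_continuous_sub {R : realType} (f : R -> R) (a b u v : R) :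
  {in `]a, b[, continuous f} -> a < u -> v < b ->
  {within `[u, v], continuous f}.
Proof.
move=> cf au vb; apply: continuous_in_subspaceT => x.
rewrite inE/= in_itv/= => /andP[ux xv].
by apply: cf; rewrite in_itv/= (lt_le_trans au ux) (le_lt_trans xv vb).
Qed.

(** Integration by parts in additive form: with both integrands nonnegative and only the boundary
    term finite, the identity makes sense even if the two integrals are infinite. *)
Lemma ge0_FTC_oo {R : realType} (f g Phi : R -> R) (a b l0 l1 : R) : a < b ->
  {in `]a, b[, continuous f} -> {in `]a, b[, continuous g} ->
  {in `]a, b[, forall x, 0 <= f x} -> {in `]a, b[, forall x, 0 <= g x} ->
  {in `]a, b[, forall x : R, is_derive x 1 Phi (f x - g x)} ->
  Phi x @[x --> a^'+] --> l0 -> Phi x @[x --> b^'-] --> l1 ->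
  (\int[lebesgue_measure]_(x in `]a, b[) (f x)%:E =
   \int[lebesgue_measure]_(x in `]a, b[) (g x)%:E + (l1 - l0)%:E)%E.
Proof.
move=> ab cf cg f0 g0 dPhi Phi0 Phi1.
have [alo hib lohi dlo dhi] := loseq_hiseqP ab.
have cvf := cvg_integral_lohi ab cf f0.
have cvg := cvg_integral_lohi ab cg g0.
rewrite -(cvg_lim _ cvf)//; apply/cvg_lim => //.
have step n : (\int[lebesgue_measure]_(x in `[loseq a b n, hiseq a b n]) (f x)%:E =
   \int[lebesgue_measure]_(x in `[loseq a b n, hiseq a b n]) (g x)%:E
   + (Phi (hiseq a b n) - Phi (loseq a b n))%:E)%E.
  set u := loseq a b n; set v := hiseq a b n.
  have int h : {in `]a, b[, continuous h} ->
      lebesgue_measure.-integrable `[u, v] (EFin \o h).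
    move=> ch; apply: continuous_compact_integrable; first exact: segment_compact.
    exact: within_continuous_sub (alo n) (hib n).
  have cfg : {in `]a, b[, continuous (f \- g)}.
    by move=> x xab; apply: cvgB; [exact: cf|exact: cg].
  rewrite EFinB -(@continuous_FTC2 _ (f \- g) Phi).
  - rewrite -integralD//=; first by apply: eq_integral => x _; rewrite -EFinD addrC subrK.
      exact: int.
    exact: (int (f \- g)).
  - exact: lohi.
  - exact: within_continuous_sub (alo n) (hib n).
  - apply: derivable_oo_LRcontinuous_sub (alo n) (lohi n) (hib n).
    by move=> x /dPhi[].
  - move=> x; rewrite in_itv/= => /andP[ux xv].
    have /dPhi dx : x \in `]a, b[ by rewrite in_itv/= (lt_trans (alo n) ux) (lt_trans xv (hib n)).
    by rewrite derive1E derive_val.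
under eq_fun do rewrite step.
apply: cvgeD; [exact: fin_num_adde_defl|exact: cvg|].
apply: cvg_EFin; first exact: nearW.
by apply: cvgB; [exact: cvg_hiseq_comp Phi1|exact: cvg_loseq_comp Phi0].
Qed.

Lemma ge0_integration_by_substitution_oo {R : realType} (F F' G : R -> R)
    (a b c d : R) : a < b ->
  {in `]a, b[ &, {homo F : x y / x < y}} ->
  {in `]a, b[, forall x, F x \in `]c, d[} ->
  {in `]a, b[, forall x : R, is_derive x 1 F (F' x)} ->
  {in `]a, b[, continuous F'} ->
  {in `]a, b[, forall x, 0 <= F' x} ->
  F x @[x --> a^'+] --> c -> F x @[x --> b^'-] --> d ->
  {in `]c, d[, continuous G} -> {in `]c, d[, forall x, 0 <= G x} ->
  (\int[lebesgue_measure]_(x in `]c, d[) (G x)%:E =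
   \int[lebesgue_measure]_(x in `]a, b[) (G (F x) * F' x)%:E)%E.
Proof.
move=> ab iF Fcd dF cF' F'0 Fa Fb cG G0.
have [alo hib lohi dlo dhi] := loseq_hiseqP ab.
have ino x : x \in `]a, b[ -> {for x, continuous F}.
  by move=> /dF[/derivable1_diffP/differentiable_continuous].
have loab n : loseq a b n \in `]a, b[.
  by rewrite in_itv/= alo (lt_trans (lohi n)).
have hiab n : hiseq a b n \in `]a, b[.
  by rewrite in_itv/= hib (lt_trans _ (lohi n)).
have iF' : {in `]a, b[ &, {homo F : x y / x <= y}}.
  move=> x y xab yab; rewrite le_eqVlt => /predU1P[->//|xy].
  exact/ltW/iF.
have cvL : (\int[lebesgue_measure]_(x in `[F (loseq a b n), F (hiseq a b n)]) (G x)%:E)%E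
    @[n --> \oo] --> (\int[lebesgue_measure]_(x in `]c, d[) (G x)%:E)%E.
  apply: cvg_integral_cc_oo => //.
  - by move=> n; have := Fcd _ (loab n); rewrite in_itv/= => /andP[].
  - by move=> n; have := Fcd _ (hiab n); rewrite in_itv/= => /andP[].
  - by move=> m n mn; apply: iF' => //; exact: dlo.
  - by move=> m n mn; apply: iF' => //; exact: dhi.
  - exact: cvg_loseq_comp Fa.
  - exact: cvg_hiseq_comp Fb.
rewrite -(cvg_lim _ cvL)//.
have cGF : {in `]a, b[, continuous (fun x => G (F x) * F' x)}.
  move=> x xab; apply: continuousM; last exact: cF'.
  apply: continuous_comp; first exact: ino.
  exact/cG/Fcd.
have := @cvg_integral_lohi _ _ _ _ ab cGF; move/(_ _)/cvg_lim => <-//; last first.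
  by move=> x xab; rewrite mulr_ge0// ?F'0// G0// Fcd.
congr (limn _); apply/funext => n.
set u := loseq a b n; set v := hiseq a b n.
have uvab : `[u, v]%classic `<=` `]a, b[%classic.
  move=> x /=; rewrite !in_itv/= => /andP[ux xv].
  by rewrite (lt_le_trans (alo n) ux) (le_lt_trans xv (hib n)).
have F'E x : x \in `]a, b[ -> derive1 F x = F' x.
  by move=> /dF dx; rewrite derive1E derive_val.
have F'near x : x \in `]a, b[ -> \forall y \near x, derive1 F y = F' y.
  move=> xab; near=> y; apply: F'E; near: y.
  exact: near_in_itvoo.
(* [derive1 F] agrees with [F'] only inside the interval, so continuity is transferred through a
   neighbourhood of [x]. *)
have cdF x : x \in `]a, b[ -> {for x, continuous (derive1 F)}.
  move=> xab; have cx : F' y @[y --> x] --> derive1 F x by rewrite F'E//; exact: cF'.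
  apply: cvg_trans cx; apply: near_eq_cvg.
  by apply: filterS (F'near x xab) => y ->.
rewrite (@integration_by_substitution_increasing _ F G u v).
- apply: eq_integral => x; rewrite inE => /uvab xab.
  by rewrite -F'E.
- exact/ltW/lohi.
- by move=> x y /uvab xab /uvab yab; exact: iF.
- move=> x xuv; apply: cdF; apply: uvab => /=.
  exact: subset_itv_oo_cc xuv.
- by apply/cvg_ex; exists (derive1 F u); exact/cvg_at_right_filter/cdF/loab.
- by apply/cvg_ex; exists (derive1 F v); exact/cvg_at_left_filter/cdF/hiab.
- apply: derivable_oo_LRcontinuous_sub (alo n) (lohi n) (hib n).
  by move=> x /dF[].
- apply: within_continuous_sub cG _ _.
    by have := Fcd _ (loab n); rewrite in_itv/= => /andP[].
  by have := Fcd _ (hiab n); rewrite in_itv/= => /andP[].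
Unshelve. all: end_near. Qed.

Lemma ge0_integral_onem {R : realType} (G : R -> R) :
  {in `]0, 1[, continuous G} -> {in `]0, 1[, forall x, 0 <= G x} ->
  (\int[lebesgue_measure]_(x in `]0%R, 1%R[) (G x)%:E =
   \int[lebesgue_measure]_(x in `]0%R, 1%R[) (G (1 - x))%:E)%E.
Proof.
move=> cG G0.
have onein (x : R) : x \in `]0, 1[ -> 1 - x \in `]0, 1[.
  by rewrite !in_itv/= => /andP[? ?]; apply/andP; split; lra.
have c1 (x : R) : {for x, continuous (fun y : R => 1 - y)}.
  by apply: cvgB; [exact: cvg_cst|exact: cvg_id].
have cG' : {in `]0, 1[, continuous (fun x : R => G (1 - x))}.
  move=> x /onein x1; apply: (@continuous_comp _ _ _ (fun x : R => 1 - x) G) => //.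
  exact: cG.
have G'0 : {in `]0, 1[, forall x : R, 0 <= G (1 - x)} by move=> x /onein /G0.
have h01 : (0 : R) < 1 by [].
rewrite -(cvg_lim _ (cvg_integral_lohi h01 cG G0))//.
rewrite -(cvg_lim _ (cvg_integral_lohi h01 cG' G'0))//.
have [alo hib lohi _ _] := loseq_hiseqP h01.
congr (limn _); apply/funext => n.
set u := loseq 0 1 n; set v := hiseq 0 1 n.
(* The exhausting intervals are symmetric about 1/2, so the reflection maps each of them onto
   itself. *)
have uE : u = 1 - v by rewrite /u /v /loseq /hiseq; ring.
have vE : v = 1 - u by rewrite uE subKr.
have onemE : derive1 (fun x : R => 1 - x) = cst (-1) by exact: (@derive1_onem R).
have := @integration_by_substitution_decreasing _ (fun x : R => 1 - x) G u v.
rewrite /= -uE -vE => ->.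
- by apply: eq_integral => x _; rewrite !fctE onemE opprK mulr1.
- exact/ltW/lohi.
- by move=> x y _ _ xy; rewrite ler_ltB.
- by rewrite onemE; move=> ? ?; exact: cvg_cst.
- by rewrite onemE; exact: is_cvg_cst.
- by rewrite onemE; exact: is_cvg_cst.
- apply: derivable_oo_LRcontinuous_sub (alo n) (lohi n) (hib n).
  by move=> x _; exact: derivableB.
- exact: within_continuous_sub (alo n) (hib n).
Qed.

(** * Tails of zeta-star values *)

(** Tannery's theorem for nonnegative terms. It is needed because in [zst] the bound [N] truncates
    the inner sums as well as the outer one. *)
Lemma cvg_sum_tannery {R : realType} (c x : R^nat) (X : nat -> R^nat) (k : nat) (l : R) :
  (forall j, 0 <= c j) -> (forall j N, (k <= j)%N -> 0 <= X j N) ->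
  (forall j N, (k <= j)%N -> X j N <= x j) ->
  (forall j, (k <= j)%N -> X j @ \oo --> x j) ->
  (\sum_(k <= j < N.+1) c j * x j) @[N --> \oo] --> l ->
  (\sum_(k <= j < N.+1) c j * X j N) @[N --> \oo] --> l.
Proof.
move=> c0 X0 Xx cX Sl.
pose S N := \sum_(k <= j < N.+1) c j * x j.
have ndS : nondecreasing_seq S.
  apply/nondecreasing_seqP => n; rewrite /S.
  have [kn|nk] := leqP k n.+1; last by rewrite !big_geq// ltnW.
  rewrite [leRHS]big_nat_recr//= lerDl mulr_ge0// (le_trans (X0 n.+1 0%N _))//.
  exact: Xx.
have Sle N : S N <= l.
  have <- : limn S = l by exact/cvg_lim.
  by apply: nondecreasing_cvgn_le => //; apply/cvg_ex; exists l.
have Tle N : \sum_(k <= j < N.+1) c j * X j N <= l.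
  apply: le_trans (Sle N); rewrite /S !big_nat; apply: ler_sum => j /andP[kj _].
  by rewrite ler_wpM2l// Xx.
apply/cvgrPdist_lt => e e0.
(* Freeze the terms up to [K]: they converge to [S K], already above [l - e], and the later terms
   only add to the sum. *)
have [K _ /(_ K (leqnn K)) SK] : \forall N \near \oo, l - e < S N.
  by apply: (cvgr_gt l) => //; rewrite ltrBlDr ltrDl.
have cT : (\sum_(k <= j < K.+1) c j * X j N) @[N --> \oo] --> S K.
  rewrite /S; under eq_fun do rewrite big_seq.
  rewrite big_seq; apply: cvg_big => [|j]; first exact: add_continuous.
  rewrite mem_index_iota => /andP[kj _].
  by apply: cvgM; [exact: cvg_cst|exact: cX].
near=> N.
rewrite ger0_norm ?subr_ge0// ltrBlDr -ltrBlDl.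
have KN : (K <= N)%N by near: N; exact: nbhs_infty_ge.
apply: (@lt_le_trans _ _ (\sum_(k <= j < K.+1) c j * X j N)).
  by near: N; exact: (cvgr_gt (S K)).
have [kK|Kk] := leqP k K.+1; last first.
  rewrite big_geq; last exact: ltnW.
  by rewrite big_nat; apply: sumr_ge0 => j /andP[kj _]; rewrite mulr_ge0// X0.
rewrite (@big_cat_nat _ _ _ K.+1 k N.+1)//= lerDl.
rewrite big_nat; apply: sumr_ge0 => j /andP[Kj _].
by rewrite mulr_ge0// X0// (leq_trans kK).
Unshelve. all: end_near. Qed.

(** [DS] separates the terms with k_1 = k from those with k_1 > k in the tail sum, and [D_cvg0]
    fixes the constant that this difference equation leaves free. *)
Section zeta_star_tails.
Context {R : realType} (D : nat -> nat -> R).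
Hypothesis D_ge0 : forall m k, (0 < k)%N -> 0 <= D m k.
Hypothesis D0 : forall k, (0 < k)%N -> D 0 k = 1.
Hypothesis DS : forall m k, (0 < k)%N ->
  D m.+1 k = D m.+1 k.+1 + k%:R ^- 2 * D m k.
Hypothesis D_cvg0 : forall m, D m.+1 @ \oo --> (0 : R).

Let telescope_D m k N : (0 < k <= N.+1)%N ->
  \sum_(k <= j < N.+1) j%:R ^- 2 * D m j = D m.+1 k - D m.+1 N.+1.
Proof.
move=> /andP[k0 kN]; rewrite -opprB -(telescope_sumr _ kN) -sumrN !big_nat.
apply: eq_bigr => j /andP[kj _]; rewrite opprB (DS m (leq_trans k0 kj)).
by rewrite addrC addKr.
Qed.

Let cvg_telescope_D m k : (0 < k)%N ->
  (\sum_(k <= j < N.+1) j%:R ^- 2 * D m j) @[N --> \oo] --> D m.+1 k.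
Proof.
move=> k0; rewrite -[X in _ --> X]subr0.
have : (D m.+1 k - D m.+1 N.+1) @[N --> \oo] --> D m.+1 k - 0.
  apply: cvgB; first exact: cvg_cst.
  by have := @D_cvg0 m; rewrite -cvg_shiftS.
apply: cvg_trans; apply: near_eq_cvg; near=> N.
rewrite telescope_D// k0/=; near: N.
by exists k => // n /= kn; exact: leqW.
Unshelve. all: end_near. Qed.

Lemma zst_nseq2_ge0 m k N : 0 <= zst (nseq m 2%N) k N :> R.
Proof.
elim: m k => [|m IH] k //=; apply: sumr_ge0 => j _.
by rewrite mulr_ge0// invr_ge0 exprn_ge0.
Qed.

Lemma zst_nseq2_le m k N : (0 < k)%N -> zst (nseq m 2%N) k N <= D m k.
Proof.
elim: m k => [|m IH] k k0 /=; first by rewrite D0.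
have [kN|Nk] := leqP k N.+1; last by rewrite big_geq ?D_ge0// ltnW.
apply: (@le_trans _ _ (\sum_(k <= j < N.+1) j%:R ^- 2 * D m j)).
  rewrite !big_nat; apply: ler_sum => j /andP[kj _].
  by rewrite ler_wpM2l ?IH ?(leq_trans k0)// invr_ge0 exprn_ge0.
by rewrite telescope_D ?k0// gerBl D_ge0.
Qed.

Lemma cvg_zst_nseq2 m k : (0 < k)%N -> zst (nseq m 2%N) k @ \oo --> D m k.
Proof.
elim: m k => [|m IH] k k0 /=; first by rewrite D0//; exact: cvg_cst.
apply: (@cvg_sum_tannery _ (fun j => j%:R ^- 2) (D m)
  (fun j N => zst (nseq m 2%N) j N)).
- by move=> j; rewrite invr_ge0 exprn_ge0.
- by move=> j N _; exact: zst_nseq2_ge0.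
- by move=> j N kj; rewrite zst_nseq2_le// (leq_trans k0).
- by move=> j kj; apply: IH; rewrite (leq_trans k0).
- exact: cvg_telescope_D.
Qed.

(** [zeta_star] is a [lim], so convergence has to be proved before its value means anything. The
    partial sums increase and, as k^-(r+2) <= k^-2, stay below [D m.+1 1]. *)
Lemma cvg_zeta_star m r :
  (\sum_(1 <= k < N.+1) k%:R ^- r.+2 * D m k) @[N --> \oo] -->
  zeta_star (r.+2 :: nseq m 2%N).
Proof.
have : cvgn (fun N => \sum_(1 <= k < N.+1) k%:R ^- r.+2 * D m k).
  apply: nondecreasing_is_cvgn.
    apply/nondecreasing_seqP => n; rewrite [leRHS]big_nat_recr//= lerDl.
    by rewrite mulr_ge0 ?D_ge0// invr_ge0 exprn_ge0.
  exists (D m.+1 1%N) => _ [N _ <-].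
  apply: (@le_trans _ _ (\sum_(1 <= j < N.+1) j%:R ^- 2 * D m j)).
    rewrite !big_nat; apply: ler_sum => j /andP[j0 _].
    rewrite ler_wpM2r ?D_ge0// lef_pV2 ?posrE ?exprn_gt0 ?ltr0n//.
    by apply: ler_weXn2l => //; rewrite ler1n.
  by rewrite telescope_D// gerBl D_ge0.
move=> /cvg_ex[l cl]; rewrite /zeta_star.
suff : zst (r.+2 :: nseq m 2%N) 1 @ \oo --> l by move/cvg_lim => ->.
apply: (@cvg_sum_tannery _ (fun j => j%:R ^- r.+2) (D m)
  (fun j N => zst (nseq m 2%N) j N)) => //.
- by move=> j N _; exact: zst_nseq2_ge0.
- by move=> j N j0; exact: zst_nseq2_le.
- by move=> j j0; exact: cvg_zst_nseq2.
Qed.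

End zeta_star_tails.

(** * Moments of the logit *)

Lemma is_derive1M {R : realType} (f g : R -> R) (x a b : R) :
  is_derive x 1 f a -> is_derive x 1 g b ->
  is_derive x 1 (fun y => f y * g y) (f x * b + g x * a).
Proof. by move=> df dg; exact: is_deriveM. Qed.

Lemma is_derive1X {R : realType} (f : R -> R) (n : nat) (x a : R) :
  is_derive x 1 f a -> is_derive x 1 (fun y => f y ^+ n) (n%:R * f x ^+ n.-1 * a).
Proof.
move=> df; rewrite (_ : (fun y => f y ^+ n) = f ^+ n); first exact: is_deriveX.
by apply/funext => y; rewrite exprfctE.
Qed.

Lemma is_derive1B {R : realType} (f g : R -> R) (x a b : R) :
  is_derive x 1 f a -> is_derive x 1 g b ->
  is_derive x 1 (fun y => f y - g y) (a - b).
Proof. by move=> df dg; exact: is_deriveB. Qed.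

Lemma is_derive1_continuous {R : realType} (f : R -> R) (x a : R) :
  is_derive x 1 f a -> {for x, continuous f}.
Proof. by move=> [/derivable1_diffP/differentiable_continuous]. Qed.

(** Half of the power of x pays for the logarithms: with x = exp (- y), the exponential series gives
    (y / 2)^n <= n! exp (y / 2). *)
Lemma mul_lnN_exp_le {R : realType} (n : nat) (x : R) : 0 < x <= 1 ->
  x * (- ln x) ^+ n <= (2 ^ n * n`!)%:R * Num.sqrt x.
Proof.
move=> /andP[x0 x1]; set y := - ln x.
have y0 : 0 <= y by rewrite oppr_ge0 ln_le0.
have xE : x = expR (- y) by rewrite opprK lnK.
have sE : Num.sqrt x = expR (- (y / 2)).
  have -> : x = expR (- (y / 2)) ^+ 2.
    by rewrite xE -expRM_natl; congr expR; field.
  by rewrite sqrtr_sqr ger0_norm ?expR_ge0.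
have yn : y ^+ n <= (2 ^ n * n`!)%:R * expR (y / 2).
  have : (y / 2) ^+ n <= n`!%:R * expR (y / 2).
    case: n => [|n].
      by rewrite expr0 fact0 mul1r -(expR0) ler_expR divr_ge0.
    have := @expR_ge1Dxn R (y / 2) n; rewrite divr_ge0// => /(_ isT) h.
    rewrite -ler_pdivrMl ?ltr0n ?fact_gt0// mulrC.
    by apply: le_trans h; rewrite lerDr.
  rewrite expr_div_n ler_pdivrMr ?exprn_gt0// => h.
  by rewrite natrM natrX; move: h; rewrite mulrC mulrA.
rewrite sE xE (_ : expR (- y) = expR (- (y / 2)) * expR (- (y / 2))); last first.
  by rewrite -expRD; congr expR; field.
rewrite mulrC mulrA ler_pM2r ?expR_gt0//.
apply: (le_trans (ler_wpM2r (expR_ge0 _) yn)).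
by rewrite -mulrA -expRD subrr expR0 mulr1.
Qed.

Definition logit {R : realType} (p : R) : R := ln p - ln (1 - p).
Definition pq {R : realType} (p : R) : R := p * (1 - p).

Lemma pq_gt0 {R : realType} (p : R) : p \in `]0, 1[ -> 0 < pq p.
Proof. by rewrite in_itv/= => /andP[p0 p1]; rewrite mulr_gt0// subr_gt0. Qed.

Lemma pq_le {R : realType} (p : R) : 4 * pq p <= 1.
Proof. by have := sqr_ge0 (1 - 2 * p); rewrite /pq; lra. Qed.

Lemma is_derive_onem {R : realType} (p : R) : is_derive p 1 (fun y : R => 1 - y) (- 1).
Proof.
rewrite -[X in is_derive _ _ _ X]sub0r; apply: is_derive1B; exact: is_derive_id.
Qed.

Lemma is_derive_pq {R : realType} (p : R) : is_derive p 1 pq (1 - 2 * p).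
Proof.
have := is_derive1M (is_derive_id p 1) (is_derive_onem p).
move/is_derive_eq; apply; by rewrite /=; ring.
Qed.

Lemma is_derive_logit {R : realType} (p : R) : p \in `]0, 1[ ->
  is_derive p 1 logit (pq p)^-1.
Proof.
move=> p01; have := pq_gt0 p01; move: p01; rewrite in_itv/= => /andP[p0 p1] w0.
have q0 : 0 < 1 - p by rewrite subr_gt0.
have := is_derive1B (is_derive1_ln p0)
  (@is_derive1_comp _ (@ln R) (fun y : R => 1 - y) p _ _ (is_derive1_ln q0) (is_derive_onem p)).
move/is_derive_eq; apply; by rewrite /pq; field; rewrite (gt_eqF p0) (gt_eqF q0).
Qed.

Lemma logit_onem {R : realType} (p : R) : logit (1 - p) = - logit p.
Proof. by rewrite /logit subKr opprB. Qed.

Lemma normr_logit_le {R : realType} (p : R) : p \in `]0, 1[ ->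
  `|logit p| <= - ln (pq p).
Proof.
rewrite in_itv/= => /andP[p0 p1].
have q0 : 0 < 1 - p by rewrite subr_gt0.
have l0 : ln p <= 0 by rewrite ln_le0// ltW.
have l1 : ln (1 - p) <= 0 by rewrite ln_le0// gerBl ltW.
by rewrite /pq lnM// /logit ler_norml; apply/andP; split; lra.
Qed.

(** By symmetry p <= 1/2. Then ln ((1 - p) / p) <= (1 - 2p) / p from ln (1 + x) <= x; multiplying by
    p (1 - p) leaves at most 1 - 2p, whose square is 1 - 4 p (1 - p). *)
Lemma sqr_logit_le {R : realType} (p : R) : p \in `]0, 1[ ->
  (logit p * pq p) ^+ 2 <= 1 - 4 * pq p.
Proof.
wlog : p / p <= 1 - p => [wl|pq1] p01.
  have [pp|pp] := leP p (1 - p); first exact: wl.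
  have /wl : 1 - p <= 1 - (1 - p) by rewrite subKr ltW.
  rewrite logit_onem mulNr sqrrN (_ : pq (1 - p) = pq p); last by rewrite /pq subKr mulrC.
  by apply; move: p01; rewrite !in_itv/= => /andP[? ?]; apply/andP; split; lra.
have w0 := pq_gt0 p01; move: p01; rewrite in_itv/= => /andP[p0 p1].
have q0 : 0 < 1 - p by rewrite subr_gt0.
have lE : - logit p = ln ((1 - p) / p) by rewrite ln_div// opprB.
have l0 : 0 <= - logit p by rewrite lE ln_ge0// ler_pdivlMr// mul1r.
have l1 : - logit p <= (1 - 2 * p) / p.
  have := @le_ln1Dx R ((1 - 2 * p) / p).
  rewrite (_ : 1 + (1 - 2 * p) / p = (1 - p) / p); last by field; rewrite gt_eqF.
  rewrite -lE; apply; apply: (@lt_le_trans _ _ 0); first by rewrite ltrN10.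
  by rewrite divr_ge0 ?(ltW p0)//; lra.
have -> : 1 - 4 * pq p = (1 - 2 * p) ^+ 2 by rewrite /pq; ring.
rewrite -sqrrN -mulNr ler_sqr ?nnegrE; last 2 first.
- by rewrite mulr_ge0// ltW.
- lra.
apply: (@le_trans _ _ ((1 - 2 * p) / p * pq p)).
  by rewrite ler_wpM2r// ltW.
rewrite /pq mulrA divfK ?gt_eqF//.
by rewrite ler_piMr//; lra.
Qed.

(** Serves to kill the boundary terms when integrating by parts. *)
Lemma cvg0_le_sqrt_pq {R : realType} (K : R) (f : R -> R) :
  {in `]0, 1[, forall p, `|f p| <= K * Num.sqrt (pq p)} ->
  f p @[p --> 0^'+] --> 0 /\ f p @[p --> 1^'-] --> 0.
Proof.
move=> fK.
have cs (x : R) : {for x, continuous (fun p => K * Num.sqrt (pq p))}.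
  apply: cvgM; first exact: cvg_cst.
  apply: (continuous_comp (is_derive1_continuous (is_derive_pq x))).
  exact: sqrt_continuous.
have h0 : K * Num.sqrt (pq 0) = 0 :> R by rewrite /pq mul0r sqrtr0 mulr0.
have h1 : K * Num.sqrt (pq 1) = 0 :> R by rewrite /pq subrr mulr0 sqrtr0 mulr0.
split; apply/norm_cvg0P.
- apply: (@squeeze_cvgr _ _ _ _ (cst 0) (fun p => K * Num.sqrt (pq p))).
  + near=> p; rewrite normr_ge0 fK// in_itv/=; apply/andP; split; near: p.
      exact: nbhs_right_gt.
    exact: nbhs_right_lt.
  + exact: cvg_cst.
  + by rewrite -[X in _ --> X]h0; exact/cvg_at_right_filter/cs.
- apply: (@squeeze_cvgr _ _ _ _ (cst 0) (fun p => K * Num.sqrt (pq p))).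
  + near=> p; rewrite normr_ge0 fK// in_itv/=; apply/andP; split; near: p.
      exact: nbhs_left_gt.
    exact: nbhs_left_lt.
  + exact: cvg_cst.
  + by rewrite -[X in _ --> X]h1; exact/cvg_at_left_filter/cs.
Unshelve. all: end_near. Qed.

Lemma logit_exp_pq_le {R : realType} (n k : nat) (p : R) : p \in `]0, 1[ ->
  `|logit p ^+ n * pq p ^+ k.+1| <= (2 ^ n * n`!)%:R * Num.sqrt (pq p).
Proof.
move=> p01; have w0 := pq_gt0 p01; have w1 := pq_le p.
have w01 : 0 < pq p <= 1 by rewrite w0/=; lra.
apply: le_trans (mul_lnN_exp_le n w01).
rewrite normrM !normrX mulrC (gtr0_norm w0) exprS -mulrA ler_pM2l//.
rewrite -[leRHS]mul1r; apply: ler_pM; rewrite ?exprn_ge0 ?(ltW w0)//.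
- by rewrite exprn_ile1 ?(ltW w0)//; lra.
- apply: lerXn2r; rewrite ?nnegrE//; last exact: normr_logit_le.
  exact: le_trans (normr_logit_le p01).
Qed.

Lemma continuous_logit_pq {R : realType} (n k : nat) :
  {in `]0, 1[, continuous (fun p : R => logit p ^+ n * pq p ^+ k)}.
Proof.
move=> p p01; apply: is_derive1_continuous.
exact: is_derive1M (is_derive1X n (is_derive_logit p01))
  (is_derive1X k (is_derive_pq p)).
Qed.

Lemma measurable_logit_pq {R : realType} (n k : nat) :
  measurable_fun (`]0, 1[ : set R) (fun p : R => logit p ^+ n * pq p ^+ k).
Proof. exact: (measurable_fun_continuous_oo (@continuous_logit_pq R n k)). Qed.

(** The weight is the unnormalized Beta(k+1, k+1) density, hence the shift by one in [nmoment].
    Values are extended reals because the recurrence is established first and then used to prove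
    finiteness. *)
Definition moment {R : realType} (k n : nat) : \bar R :=
  (\int[lebesgue_measure]_(p in `]0%R, 1%R[) (logit p ^+ n * pq p ^+ k)%:E)%E.

Lemma logit_pq_ge0 {R : realType} (m k : nat) (p : R) : p \in `]0, 1[ ->
  0 <= logit p ^+ m.*2 * pq p ^+ k.
Proof.
move=> p01; apply: mulr_ge0; first by rewrite exprn_even_ge0 ?odd_double.
by rewrite exprn_ge0// ltW// pq_gt0.
Qed.

Lemma moment_ge0 {R : realType} (k m : nat) : (0 <= moment k m.*2 :> \bar R)%E.
Proof. by apply: integral_ge0 => p p01; rewrite lee_fin logit_pq_ge0. Qed.

(** Two integrations by parts merged into one primitive. With n = 2m and L the logit, [Phi] is
    chosen so that the L^(n-1) terms of its derivative cancel; 4c + 2 comes from (1 - 2p)^2 = 1 - 4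
    p (1 - p). For m = 0 the last coefficient is 0, so the truncated predecessors are harmless. *)
Lemma moment_rec {R : realType} (k m : nat) (c := k.+1%:R : R) :
  ((c ^+ 2)%:E * moment k m.*2 =
  (c * (4 * c + 2))%:E * moment k.+1 m.*2 +
  (m.*2%:R * m.*2.-1%:R)%:E * moment k (m.-1).*2)%E.
Proof.
have c0 : 0 <= c by exact: ler0n.
have c1_0 : 0 <= c ^+ 2 by rewrite exprn_ge0.
have c2_0 : 0 <= c * (4 * c + 2) by rewrite mulr_ge0// addr_ge0// mulr_ge0.
have c3_0 : 0 <= m.*2%:R * m.*2.-1%:R :> R by rewrite mulr_ge0.
(* The coefficients become opaque until the derivative of [Phi] is compared with the integrands. *)
have [c1 c1E] : exists c1, c1 = c ^+ 2 by eexists.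
have [c2 c2E] : exists c2, c2 = c * (4 * c + 2) by eexists.
have [c3 c3E] : exists c3, c3 = m.*2%:R * m.*2.-1%:R :> R by eexists.
rewrite -c1E -c2E -c3E in c1_0 c2_0 c3_0 *.
have cM (e : R) (n l : nat) : {in `]0, 1[, continuous (fun p : R => e * (logit p ^+ n * pq p ^+ l))}.
  move=> p p01; apply: cvgM; first exact: cvg_cst.
  exact: continuous_logit_pq.
have M0 (e : R) (n l : nat) p : p \in `]0, 1[ -> 0 <= e -> 0 <= e * (logit p ^+ n.*2 * pq p ^+ l).
  by move=> p01 e0; rewrite mulr_ge0// logit_pq_ge0.
have IM (e : R) (n l : nat) : 0 <= e -> (e%:E * moment l n.*2)%E =
    (\int[lebesgue_measure]_(p in `]0%R, 1%R[) (e * (logit p ^+ n.*2 * pq p ^+ l))%:E)%E.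
  move=> e0; under [RHS]eq_integral do rewrite EFinM.
  rewrite ge0_integralZl_EFin//.
  - by move=> p p01; rewrite lee_fin logit_pq_ge0.
  - apply/measurable_EFinP; exact: measurable_logit_pq.
rewrite !IM// -ge0_integralD//=; last 4 first.
- by move=> p p01; rewrite lee_fin M0.
- apply/measurable_EFinP; exact: (measurable_fun_continuous_oo (cM _ _ _)).
- by move=> p p01; rewrite lee_fin M0.
- apply/measurable_EFinP; exact: (measurable_fun_continuous_oo (cM _ _ _)).
pose n := m.*2.
pose Phi (p : R) := (c * (1 - 2 * p) * logit p ^+ n - n%:R * logit p ^+ n.-1) * pq p ^+ k.+1.
pose K : R := c * (2 ^ n * n`!)%:R + n%:R * (2 ^ n.-1 * (n.-1)`!)%:R.
have PhiK : {in `]0, 1[, forall p, `|Phi p| <= K * Num.sqrt (pq p)}.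
  move=> p p01; rewrite /Phi mulrBl (le_trans (ler_normB _ _))// /K [leRHS]mulrDl.
  apply: lerD.
    rewrite -!mulrA normrM (ger0_norm c0) ler_wpM2l// normrM -[leRHS]mul1r.
    apply: ler_pM => //; last exact: logit_exp_pq_le.
    by move: p01; rewrite in_itv/= => /andP[p0 p1]; rewrite ler_norml; lra.
  by rewrite -!mulrA normrM normr_nat ler_wpM2l// logit_exp_pq_le.
have [Phi0 Phi1] := cvg0_le_sqrt_pq PhiK.
under [in RHS]eq_integral do rewrite -EFinD.
rewrite (@ge0_FTC_oo R (fun p => c1 * (logit p ^+ m.*2 * pq p ^+ k))
  (fun p => c2 * (logit p ^+ m.*2 * pq p ^+ k.+1) +
    c3 * (logit p ^+ (m.-1).*2 * pq p ^+ k)) Phi 0 1 0 0 ltr01).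
- by rewrite subrr adde0.
- exact: (cM c1 m.*2 k).
- move=> p p01; apply: cvgD; first exact: (cM c2 m.*2 k.+1 p p01).
  exact: (cM c3 (m.-1).*2 k p p01).
- by move=> p p01; exact: M0.
- by move=> p p01; apply: addr_ge0; exact: M0.
2,3: by [exact: Phi0|exact: Phi1].
move=> p p01; have := p01; rewrite in_itv/= => /andP[p0 p1].
have dl := is_derive_logit p01; have dw := is_derive_pq p.
have d2 : is_derive p 1 (fun y : R => c * (1 - 2 * y)) (- 2 * c).
  have d0 := is_derive1B (is_derive_cst (1:R) p 1) (is_derive1M (is_derive_cst (2:R) p 1) (is_derive_id p 1)).
  have := is_derive1M (is_derive_cst (c:R) p 1) d0.
  by move/is_derive_eq; apply; rewrite /=; ring.
have := is_derive1M (is_derive1B (is_derive1M d2 (is_derive1X n dl))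
  (is_derive1M (is_derive_cst (n%:R : R) p 1) (is_derive1X n.-1 dl))) (is_derive1X k.+1 dw).
move/is_derive_eq; apply.
rewrite (_ : (m.-1).*2 = n.-1.-1); last by rewrite /n; case: (m).
rewrite c1E c2E c3E -/n exprS /= -[k.+1%:R]/c.
move: (logit p ^+ n) (logit p ^+ n.-1) (logit p ^+ n.-1.-1) (pq p ^+ k) (n%:R : R) (n.-1%:R : R) (c : R) => a b d e f g h.
rewrite /pq; field.
by rewrite (gt_eqF p0) subr_eq0 gt_eqF.
Qed.

Lemma lebesgue_measure_oo01 {R : realType} :
  lebesgue_measure (`]0, 1[ : set R) = 1%E.
Proof. by rewrite lebesgue_measure_itv/= lte_fin ltr01 sube0. Qed.

Lemma moment00 {R : realType} : moment 0 0 = 1%E :> \bar R.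
Proof.
rewrite /moment; under eq_integral do rewrite expr0 expr0 mulr1.
by rewrite integral_cst//= lebesgue_measure_oo01 mule1.
Qed.

(** With at least one factor [pq p] the integrand is bounded. For k = 0 it is unbounded when m > 0,
    and the recurrence at k = 0 expresses the moment through [moment 1] and a lower power of the
    logit. *)
Lemma moment_fin {R : realType} (k m : nat) : (moment k m.*2 : \bar R) \is a fin_num.
Proof.
have finS l n : (moment l.+1 n.*2 : \bar R) \is a fin_num.
  rewrite ge0_fin_numE ?moment_ge0//.
  have := @ge0_le_integral _ _ R lebesgue_measure (`]0, 1[) (measurable_itv _)
    (fun p => (logit p ^+ n.*2 * pq p ^+ l.+1)%:E)
    (cst ((2 ^ n.*2 * (n.*2)`!)%:R : R)%:E).
  rewrite integral_cst//= lebesgue_measure_oo01 => h.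
  apply: (le_lt_trans (h _ _ _ _)); last by rewrite mule1 ltry.
  - by move=> p p01; rewrite lee_fin logit_pq_ge0.
  - apply/measurable_EFinP; exact: measurable_logit_pq.
  - exact: measurable_cst.
  - move=> p p01; rewrite lee_fin (le_trans (ler_norm _))//.
    apply: (le_trans (logit_exp_pq_le _ _ p01)).
    rewrite -[leRHS]mulr1 ler_wpM2l// -sqrtr1 ler_sqrt//.
    by have := @pq_le R p; have := pq_gt0 p01; lra.
case: k => [|k]; last exact: finS.
elim: m => [|m IH]; first by rewrite moment00.
have := @moment_rec R 0 m.+1; rewrite /= mulr1n expr1n mul1e => ->.
by rewrite fin_numD !fin_numM//= ?finS//.
Qed.

Definition rmoment {R : realType} (k m : nat) : R := fine (moment k m.*2).

Lemma rmomentE {R : realType} (k m : nat) : moment k m.*2 = (rmoment k m)%:E :> \bar R.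
Proof. by rewrite fineK// moment_fin. Qed.

Lemma rmoment_ge0 {R : realType} (k m : nat) : 0 <= rmoment k m :> R.
Proof. by rewrite -lee_fin -rmomentE moment_ge0. Qed.

Lemma rmoment_rec {R : realType} (k m : nat) (c := k.+1%:R : R) :
  c ^+ 2 * rmoment k m = c * (4 * c + 2) * rmoment k.+1 m +
  m.*2%:R * m.*2.-1%:R * rmoment k m.-1.
Proof. by apply: EFin_inj; rewrite EFinD !EFinM -!rmomentE -!EFinM moment_rec. Qed.

(** [sqr_logit_le] multiplied by the integrand of [moment k m.*2] and integrated. *)
Lemma rmoment_le {R : realType} (k m : nat) :
  rmoment k.+2 m.+1 <= rmoment k m - 4 * rmoment k.+1 m :> R.
Proof.
rewrite lerBrDr -lee_fin EFinD EFinM -!rmomentE /moment.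
rewrite -ge0_integralZl_EFin//; last 2 first.
- by move=> p p01; rewrite lee_fin logit_pq_ge0.
- apply/measurable_EFinP; exact: measurable_logit_pq.
rewrite -ge0_integralD//; last 4 first.
- by move=> p p01; rewrite lee_fin logit_pq_ge0.
- apply/measurable_EFinP; exact: measurable_logit_pq.
- by move=> p p01; rewrite -EFinM lee_fin mulr_ge0// logit_pq_ge0.
- apply: emeasurable_funM; first exact: measurable_cst.
  apply/measurable_EFinP; exact: measurable_logit_pq.
apply: ge0_le_integral => //.
- move=> p p01; rewrite -EFinM -EFinD lee_fin.
  apply: addr_ge0; first exact: logit_pq_ge0.
  by apply: mulr_ge0 => //; exact: logit_pq_ge0.
- apply: emeasurable_funD; last apply: emeasurable_funM.
  + apply/measurable_EFinP; exact: measurable_logit_pq.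
  + exact: measurable_cst.
  + apply/measurable_EFinP; exact: measurable_logit_pq.
- apply/measurable_EFinP; exact: measurable_logit_pq.
- move=> p p01; rewrite -EFinM -EFinD lee_fin.
  have h0 := logit_pq_ge0 m k p01.
  have h1 := sqr_logit_le p01.
  rewrite (_ : m.+1.*2 = m.*2 + 2)%N ?exprD; last by rewrite doubleS addn2.
  rewrite (_ : k.+2 = k + 2)%N ?exprD ?addn2// (exprS _ k).
  have := ler_wpM2l h0 h1; rewrite -subr_ge0 => h.
  rewrite -subr_ge0; apply: (le_trans h); rewrite le_eqVlt; apply/orP; left.
  by apply/eqP; ring.
Qed.

(* The central binomial coefficient C(2k, k). *)
Definition cbin {R : realType} (k : nat) : R :=
  \prod_(i < k) ((4 * i%:R + 2) / i.+1%:R).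

Lemma cbin0 {R : realType} : cbin 0 = 1 :> R.
Proof. by rewrite /cbin big_ord0. Qed.

Lemma cbinS {R : realType} (k : nat) :
  cbin k.+1 = cbin k * ((4 * k%:R + 2) / k.+1%:R) :> R.
Proof. by rewrite /cbin big_ord_recr. Qed.

Lemma cbin_gt0 {R : realType} (k : nat) : 0 < cbin k :> R.
Proof. by apply: prodr_gt0 => i _; rewrite divr_gt0// ltr_wpDl// mulr_ge0. Qed.

(** The Beta function value B(k+1, k+1) = 2 / ((k+1) C(2k+2, k+1)), obtained from the recurrence for
    m = 0. *)
Lemma cbin_rmoment {R : realType} (k : nat) :
  k.+1%:R * cbin k.+1 / 2 * rmoment k 0 = 1 :> R.
Proof.
elim: k => [|k IH].
  rewrite cbinS cbin0 /rmoment moment00/=; by field.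
have := @rmoment_rec R k 0; rewrite /= mulr0n !mul0r addr0 => rec.
have k0 : k.+1%:R != 0 :> R by rewrite pnatr_eq0.
have rec' : rmoment k 0 = (4 * k.+1%:R + 2) / k.+1%:R * rmoment k.+1 0 :> R.
  apply: (mulfI (expf_neq0 2 k0)); rewrite rec; field.
  by rewrite nat1r.
rewrite -[RHS]IH rec' cbinS; field.
by rewrite nat1r -natrD !pnatr_eq0.
Qed.

(* The 2m-th moment of the logit under the Beta(k, k) distribution, over (2m)!;
   k * cbin k / 2 is the reciprocal of the Beta function at (k, k). *)
Definition nmoment {R : realType} (m k : nat) : R :=
  k%:R * cbin k / 2 * rmoment k.-1 m / (m.*2)`!%:R.

Lemma nmoment_ge0 {R : realType} (m k : nat) : (0 < k)%N -> 0 <= nmoment m k :> R.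
Proof.
move=> _; rewrite /nmoment divr_ge0// mulr_ge0 ?rmoment_ge0// divr_ge0//.
by rewrite mulr_ge0// ltW// cbin_gt0.
Qed.

Lemma nmoment0 {R : realType} (k : nat) : (0 < k)%N -> nmoment 0 k = 1 :> R.
Proof. by case: k => // k _; rewrite /nmoment cbin_rmoment divr1. Qed.

(** In [rmoment_rec] divided by c^2, the factor (4c + 2) / c turns the normalizing constant at c
    into the one at c + 1, and (2m+2) (2m+1) is absorbed by the factorial. *)
Lemma nmomentS {R : realType} (m k : nat) : (0 < k)%N ->
  nmoment m.+1 k = nmoment m.+1 k.+1 + k%:R ^- 2 * nmoment m k :> R.
Proof.
case: k => // k _; rewrite /nmoment /= (cbinS k.+1).
have := @rmoment_rec R k m.+1; rewrite /= doubleS /= => rec.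
have k0 : k.+1%:R != 0 :> R by rewrite pnatr_eq0.
have -> : rmoment k m.+1 = ((4 * k.+1%:R + 2) * rmoment k.+1 m.+1 / k.+1%:R +
    m.*2.+2%:R * m.*2.+1%:R * rmoment k m / k.+1%:R ^+ 2) :> R.
  apply: (mulfI (expf_neq0 2 k0)); rewrite rec; field.
  by rewrite nat1r.
rewrite ?doubleS !factS !natrM; field.
by rewrite !nat1r -!natrD !pnatr_eq0 -!lt0n fact_gt0.
Qed.

(** [nmoment m] has some limit c, being constant or decreasing from index 1 on. After normalization
    [rmoment_le] bounds [nmoment m.+1] by a multiple of an expression tending to 16 c - 16 c, so the
    value of c does not matter. *)
Lemma cvg_nmoment {R : realType} (m : nat) : nmoment m.+1 @ \oo --> (0 : R).
Proof.
have [c Dc] : exists c : R, nmoment m @ \oo --> c.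
  case: m => [|m].
    exists 1; rewrite -cvg_shiftS.
    under eq_fun do rewrite nmoment0//.
    exact: cvg_cst.
  have : cvgn (fun k => nmoment m.+1 k.+1 : R).
    apply: nonincreasing_is_cvgn.
      apply/nonincreasing_seqP => n; rewrite [leRHS]nmomentS// lerDl.
      by rewrite mulr_ge0 ?nmoment_ge0// invr_ge0 exprn_ge0.
    by exists 0 => _ [n _ <-]; exact: nmoment_ge0.
  by move=> /cvg_ex[c]; rewrite cvg_shiftS => cc; exists c.
(* The ratio [e k.+1 / e k] of consecutive normalizing constants. *)
pose r (k : nat) : R := 4 + 2 / k.+1%:R.
have r4 : r @ \oo --> (4 : R).
  rewrite -[X in _ --> X]addr0 -[X in _ + X](mulr0 2).
  apply: cvgD; first exact: cvg_cst.
  by apply: cvgM; [exact: cvg_cst|exact: cvg_harmonic].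
have up (k : nat) : nmoment m.+1 k.+3 <= (m.*2)`!%:R / (m.+1.*2)`!%:R *
    (r k.+1 * r k * nmoment m k.+1 - 4 * (r k.+1 * nmoment m k.+2)) :> R.
  pose e (k : nat) : R := k.+1%:R * cbin k.+1 / 2.
  have eS l : e l.+1 = e l * r l.
    rewrite /e /r (cbinS l.+1); field; by rewrite !nat1r -!natrD !pnatr_eq0.
  have e0 l : 0 <= e l by rewrite divr_ge0// mulr_ge0// ltW// cbin_gt0.
  rewrite /nmoment -/(e k.+2) -/(e k.+1) -/(e k) /=.
  rewrite [leLHS]mulrAC.
  apply: (le_trans (ler_wpM2l _ (rmoment_le k m))).
    by rewrite divr_ge0.
  rewrite !eS le_eqVlt; apply/orP; left; apply/eqP; field.
  by rewrite !pnatr_eq0 -!lt0n !fact_gt0.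
rewrite -(cvg_shiftn 3).
apply: (@squeeze_cvgr _ _ _ _ (cst 0) (fun k => (m.*2)`!%:R / (m.+1.*2)`!%:R *
    (r k.+1 * r k * nmoment m k.+1 - 4 * (r k.+1 * nmoment m k.+2)))).
- by apply: nearW => k; rewrite /= addn3 up nmoment_ge0.
- exact: cvg_cst.
- rewrite (_ : (0 : R) = (m.*2)`!%:R / (m.+1.*2)`!%:R * (4 * 4 * c - 4 * (4 * c))); last by ring.
  have r4' : r k.+1 @[k --> \oo] --> (4 : R) by rewrite (@cvg_shiftS _ r).
  have Dc1 : nmoment m k.+1 @[k --> \oo] --> c by rewrite (@cvg_shiftS _ (nmoment m)).
  have Dc2 : nmoment m k.+2 @[k --> \oo] --> c by rewrite (@cvg_shiftS _ (fun k => nmoment m k.+1)).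
  apply: cvgM; first exact: cvg_cst.
  apply: cvgB.
    by apply: cvgM => //; exact: cvgM.
  by apply: cvgM; [exact: cvg_cst|exact: cvgM].
Qed.

(** * The central binomial series *)

Lemma cbin_le {R : realType} (k : nat) : cbin k <= 4 ^+ k :> R.
Proof.
elim: k => [|k IH]; first by rewrite cbin0 expr0.
rewrite cbinS exprSr; have r0 : 0 <= (4 * k%:R + 2) / k.+1%:R :> R by rewrite divr_ge0// addr_ge0// mulr_ge0.
apply: ler_pM => //; first exact/ltW/cbin_gt0.
by rewrite ler_pdivrMr// -natr1; lra.
Qed.

(** With z = q^2, n q^n is at most the geometric sum of q^i over i < n, hence at most 1 / (1 - q);
    the other factor q^n tends to 0. *)
Lemma cvg_natM_expr {R : realType} (z : R) : 0 <= z < 1 ->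
  n%:R * z ^+ n @[n --> \oo] --> 0.
Proof.
move=> /andP[z0 z1]; set q := Num.sqrt z.
have q0 : 0 <= q by exact: sqrtr_ge0.
have q1 : q < 1 by rewrite -sqrtr1 ltr_sqrt.
have nq n : n%:R * q ^+ n <= (1 - q)^-1.
  apply: (@le_trans _ _ (\sum_(i < n) q ^+ i)).
    rewrite mulr_natl -[X in _ *+ X]card_ord -sumr_const.
    apply: ler_sum => i _.
    by rewrite ler_wiXn2l ?(ltW q1) ?(ltnW (ltn_ord i)).
  rewrite -[leRHS]mul1r ler_pdivlMr ?subr_gt0//.
  have -> : (\sum_(i < n) q ^+ i) * (1 - q) = 1 - q ^+ n by rewrite -[RHS]opprB subrX1 -mulNr opprB mulrC.
  by rewrite gerBl exprn_ge0.
apply: (@squeeze_cvgr _ _ _ _ (cst 0) (fun n => (1 - q)^-1 * q ^+ n)).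
- apply: nearW => n; rewrite mulr_ge0 ?exprn_ge0//=.
  rewrite -(sqr_sqrtr z0) -/q -exprM mul2n -addnn exprD mulrA.
  by rewrite ler_wpM2r// exprn_ge0.
- exact: cvg_cst.
- rewrite -[X in _ --> X](mulr0 (1 - q)^-1).
  apply: cvgM; [exact: cvg_cst|apply: cvg_expr].
  by rewrite ger0_norm.
Qed.

(* With x = u (1 - u) the generating function of the central binomial
   coefficients becomes 1 / (1 - 2 u), and the remainder of the partial sums
   is controlled by the derivative of a polynomial in u. *)
Lemma cvg_cbin_series {R : realType} (u : R) : 0 <= u -> 2 * u < 1 ->
  (\sum_(0 <= k < n.+1) cbin k * pq u ^+ k) @[n --> \oo] --> (1 - 2 * u)^-1.
Proof.
move=> u0 u1.
pose h (n : nat) (v : R) : R := (\sum_(0 <= k < n.+1) cbin k * pq v ^+ k) * (1 - 2 * v).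
(* The derivative of [h n] telescopes to a single term, because (n+1) C(2n+2, n+1) = (4n+2) C(2n,
   n). *)
pose dh (n : nat) (v : R) : R := - ((4 * n%:R + 2) * cbin n * pq v ^+ n).
have d2 (v : R) : is_derive v 1 (fun y : R => 1 - 2 * y) (- 2).
  have := is_derive1B (is_derive_cst (1:R) v 1) (is_derive1M (is_derive_cst (2:R) v 1) (is_derive_id v 1)).
  by move/is_derive_eq; apply; rewrite /=; ring.
have dhP (n : nat) (v : R) : is_derive v 1 (h n) (dh n v).
  elim: n => [|n IH].
    rewrite /h /dh; under eq_fun do rewrite big_nat1 expr0 mulr1.
    have := is_derive1M (is_derive_cst (cbin 0 : R) v 1) (d2 v).
    by move/is_derive_eq; apply; rewrite /= cbin0; ring.
  have -> : h n.+1 = fun y : R => h n y - - (cbin n.+1 * pq y ^+ n.+1 * (1 - 2 * y)).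
    by apply/funext => y; rewrite /h big_nat_recr//=; ring.
  have dl := is_derive1M (is_derive1M (is_derive_cst (cbin n.+1 : R) v 1)
    (is_derive1X n.+1 (is_derive_pq v))) (d2 v).
  have := is_derive1B IH (is_deriveN dl).
  move/is_derive_eq; apply; rewrite /dh /= cbinS exprS.
  move: (cbin n) (pq v ^+ n) => a b; rewrite /pq; field.
  by rewrite nat1r pnatr_eq0.
have h0 n : h n 0 = 1.
  rewrite /h big_nat_recl//= big1_seq ?cbin0 ?expr0; first by ring.
  by move=> i _; rewrite /pq mul0r exprS !mul0r mulr0.
have pqu (v : R) : 0 <= v <= u -> 0 <= pq v <= pq u.
  by move=> /andP[v0 vu]; rewrite /pq; apply/andP; split; nra.
(* Mean value theorem from [h n 0 = 1], with [cbin n <= 4 ^+ n]. The error vanishes since 2u < 1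
   forces 4 u (1 - u) < 1. *)
have hu n : 1 - u * ((4 * n%:R + 2) * (4 * pq u) ^+ n) <= h n u <= 1.
  move: u0; rewrite le_eqVlt => /predU1P[<-|u0].
    by rewrite h0 mul0r subr0 lexx.
  have [c] := @MVT R (h n) (dh n) 0 u u0 (fun v _ => dhP n v)
    (continuous_subspaceT (fun v => is_derive1_continuous (dhP n v))).
  rewrite in_itv/= => /andP[c0 cu]; rewrite h0 subr0 => hE.
  have /pqu/andP[w0 wu] : 0 <= c <= u by rewrite (ltW c0) (ltW cu).
  have -> : h n u = 1 + dh n c * u by rewrite -hE; ring.
  have a0 : 0 <= 4 * n%:R + 2 :> R by rewrite addr_ge0// mulr_ge0.
  have b0 : 0 <= (4 * n%:R + 2) * cbin n * pq c ^+ n.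
    apply: mulr_ge0; last exact: exprn_ge0.
    by apply: mulr_ge0 => //; exact/ltW/cbin_gt0.
  have b1 : (4 * n%:R + 2) * cbin n * pq c ^+ n <= (4 * n%:R + 2) * (4 * pq u) ^+ n.
    rewrite -mulrA ler_wpM2l//.
    rewrite [(4 * _) ^+ _]exprMn; apply: ler_pM; [exact/ltW/cbin_gt0|exact: exprn_ge0|exact: cbin_le|].
    by apply: lerXn2r; rewrite ?nnegrE// (le_trans w0).
  rewrite /dh mulNr [in X in _ && X]gerBl mulr_ge0 ?(ltW u0)// andbT lerB//.
  by rewrite mulrC ler_wpM2l// ltW.
have ch : h n u @[n --> \oo] --> (1 : R).
  apply: (@squeeze_cvgr _ _ _ _ (fun n => 1 - u * ((4 * n%:R + 2) * (4 * pq u) ^+ n)) (cst 1)).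
  - exact: nearW.
  - have z01 : 0 <= 4 * pq u < 1 by rewrite /pq; apply/andP; split; nra.
    rewrite -[X in _ --> X]subr0; apply: cvgB; first exact: cvg_cst.
    rewrite -(mulr0 u); apply: cvgM; first exact: cvg_cst.
    rewrite (_ : (fun _ => _) = (fun n => 4 * (n%:R * (4 * pq u) ^+ n) + 2 * (4 * pq u) ^+ n)); last first.
      by apply/funext => n; ring.
    rewrite [X in _ --> X](_ : 0 = 4 * 0 + 2 * 0 :> R); last by ring.
    apply: cvgD; apply: cvgM; try exact: cvg_cst.
      exact: cvg_natM_expr.
    by apply: cvg_expr; rewrite ger0_norm; case/andP: z01.
  - exact: cvg_cst.
have n0 : 1 - 2 * u != 0 by rewrite gt_eqF// subr_gt0.
rewrite (_ : (fun _ => _) = fun n => h n u * (1 - 2 * u)^-1); last first.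
  by apply/funext => n; rewrite /h mulfK.
rewrite -[X in _ --> X]mul1r; apply: cvgM => //; exact: cvg_cst.
Qed.

Lemma cvg_cbin_series_shift {R : realType} (u : R) : 0 < u -> 2 * u < 1 ->
  (\sum_(0 <= k < n) cbin k.+1 / 2 * pq u ^+ k) @[n --> \oo] -->
  ((1 - 2 * u) * (1 - u))^-1.
Proof.
move=> u0 u1; have x0 : pq u != 0.
  by rewrite /pq mulf_neq0// ?(gt_eqF u0)// gt_eqF//; lra.
rewrite (_ : (fun _ => _) = fun n =>
   (\sum_(0 <= k < n.+1) cbin k * pq u ^+ k - 1) * (2 * pq u)^-1); last first.
  apply/funext => n; rewrite big_nat_recl// expr0 cbin0 mulr1 addrC addKr.
  rewrite mulr_suml; apply: eq_bigr => k _; rewrite exprS.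
  by move: (cbin _) (pq u ^+ k) => a b; field.
rewrite (_ : ((1 - 2 * u) * (1 - u))^-1 = ((1 - 2 * u)^-1 - 1) * (2 * pq u)^-1); last first.
  rewrite /pq; field; apply/and3P; split; apply/eqP; lra.
apply: cvgM; last exact: cvg_cst.
apply: cvgB; last exact: cvg_cst.
exact/cvg_cbin_series/u1/ltW.
Qed.

(** Integration over b = (1 - t2) / (1 - t1), which produces the power of k+1 in the zeta-star
    value; by parts, by induction on r. *)
Lemma integral_lnN_exp {R : realType} (k r : nat) :
  (\int[lebesgue_measure]_(b in `]0%R, 1%R[) ((- ln b) ^+ r * b ^+ k)%:E =
   (r`!%:R / k.+1%:R ^+ r.+1 : R)%:E)%E.
Proof.
have c0 : (0 : R) <= k.+1%:R by [].
have cn0 : (k.+1%:R : R) != 0 by rewrite pnatr_eq0.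
have dl (b : R) : b \in `]0, 1[ -> is_derive b 1 (fun y => - ln y) (- b^-1).
  by rewrite in_itv/= => /andP[b0 _]; apply: is_deriveN; exact: is_derive1_ln.
have d (n l : nat) (b : R) : b \in `]0, 1[ -> is_derive b 1 (fun y : R => (- ln y) ^+ n * y ^+ l)
    ((- ln b) ^+ n * (l%:R * b ^+ l.-1) - n%:R * (- ln b) ^+ n.-1 / b * b ^+ l).
  move=> b01; have := is_derive1M (is_derive1X n (dl _ b01)) (is_derive1X l (is_derive_id b 1)).
  by move/is_derive_eq; apply; rewrite /=; ring.
have cM (e : R) (n : nat) : {in `]0, 1[, continuous (fun b : R => e * ((- ln b) ^+ n * b ^+ k))}.
  move=> b b01; apply: cvgM; first exact: cvg_cst.
  exact: is_derive1_continuous (d n k b b01).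
have M0 (e : R) (n : nat) (b : R) : 0 <= e -> b \in `]0, 1[ -> 0 <= e * ((- ln b) ^+ n * b ^+ k).
  move=> e0; rewrite in_itv/= => /andP[b0 b1].
  by rewrite !mulr_ge0 ?exprn_ge0 ?(ltW b0)// oppr_ge0 ln_le0// ltW.
have IM (e : R) (n : nat) : 0 <= e ->
    (e%:E * \int[lebesgue_measure]_(b in `]0%R, 1%R[) ((- ln b) ^+ n * b ^+ k)%:E =
    \int[lebesgue_measure]_(b in `]0%R, 1%R[) (e * ((- ln b) ^+ n * b ^+ k))%:E)%E.
  move=> e0; under [RHS]eq_integral do rewrite EFinM.
  rewrite ge0_integralZl_EFin//.
  - by move=> b b01; rewrite lee_fin -[leRHS]mul1r M0.
  - apply/measurable_EFinP.
    exact: (measurable_fun_continuous_oo (fun b b01 => is_derive1_continuous (d n k b b01))).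
have lim1 (n l : nat) : (- ln b) ^+ n * b ^+ l @[b --> (1:R)^'-] --> ((- ln 1) ^+ n * 1 ^+ l : R).
  apply: cvg_at_left_filter; apply: cvgM; last exact: exprn_continuous.
  apply: (@continuous_comp _ _ _ (fun b : R => - ln b) (fun y => y ^+ n)); last exact: exprn_continuous.
  by apply: cvgN; exact: continuous_ln.
have lim0 (n l : nat) : (- ln b) ^+ n * b ^+ l.+1 @[b --> (0:R)^'+] --> (0 : R).
  apply/norm_cvg0P.
  apply: (@squeeze_cvgr _ _ _ _ (cst 0) (fun b => (2 ^ n * n`!)%:R * Num.sqrt b)).
  + near=> b.
    have b0 : 0 < b by near: b; exact: nbhs_right_gt.
    have b1 : b < 1 by near: b; exact: nbhs_right_lt.
    have y0 : 0 <= - ln b by rewrite oppr_ge0 ln_le0// ltW.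
    rewrite normr_ge0 ger0_norm ?mulr_ge0 ?exprn_ge0 ?(ltW b0)//=.
    have := @mul_lnN_exp_le _ n b; rewrite b0 ltW// => /(_ isT); apply: le_trans.
    by rewrite mulrC ler_wpM2r ?exprn_ge0// exprS ler_piMr ?(ltW b0)// exprn_ile1 ?ltW.
  + exact: cvg_cst.
  + rewrite [X in _ --> X](_ : 0 = (2 ^ n * n`!)%:R * Num.sqrt 0 :> R); last by rewrite sqrtr0 mulr0.
    apply: cvg_at_right_filter; apply: cvgM; first exact: cvg_cst.
    exact: sqrt_continuous.
elim: r => [|r IH].
  have Phi1 : k.+1%:R^-1 * ((- ln b) ^+ 0 * b ^+ k.+1) @[b --> (1 : R)^'-] -->
      (k.+1%:R^-1 * ((- ln 1) ^+ 0 * 1 ^+ k.+1) : R).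
    by apply: cvgM; [exact: cvg_cst|exact: lim1].
  have Phi0 : k.+1%:R^-1 * ((- ln b) ^+ 0 * b ^+ k.+1) @[b --> (0 : R)^'+] -->
      (k.+1%:R^-1 * 0 : R).
    by apply: cvgM; [exact: cvg_cst|exact: lim0].
  have := @ge0_FTC_oo R (fun b => 1 * ((- ln b) ^+ 0 * b ^+ k)) (fun=> 0)
    (fun b => k.+1%:R^-1 * ((- ln b) ^+ 0 * b ^+ k.+1)) 0 1 _ _ ltr01 _ _ _ _ _ Phi0 Phi1.
  rewrite integral0 add0e -IM// mul1e => ->.
  - by rewrite expr0 expr1n !mulr1 mulr0 subr0 expr1 fact0 mul1r.
  - exact: cM.
  - by move=> ? _; exact: cvg_cst.
  - by move=> b b01; exact: M0.
  - by [].
  - move=> b b01; have := is_derive1M (is_derive_cst (k.+1%:R^-1 : R) b 1) (d 0%N k.+1 b b01).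
    move/is_derive_eq; apply; move: b01; rewrite in_itv/= => /andP[b0 _].
    by rewrite !expr0; field; rewrite nat1r pnatr_eq0 (gt_eqF b0).
have Phi1 : (- ln b) ^+ r.+1 * b ^+ k.+1 @[b --> (1 : R)^'-] --> (0 : R).
  by have := lim1 r.+1 k.+1; rewrite ln1 oppr0 (exprS 0) !mul0r.
have h : (k.+1%:R%:E * \int[lebesgue_measure]_(b in `]0%R, 1%R[) ((- ln b) ^+ r.+1 * b ^+ k)%:E =
    (r.+1%:R * (r`!%:R / k.+1%:R ^+ r.+1) : R)%:E)%E.
  rewrite EFinM -IH !IM//.
  rewrite (@ge0_FTC_oo R (fun b => k.+1%:R * ((- ln b) ^+ r.+1 * b ^+ k))
    (fun b => r.+1%:R * ((- ln b) ^+ r * b ^+ k))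
    (fun b => (- ln b) ^+ r.+1 * b ^+ k.+1) 0 1 0 0 ltr01).
  - by rewrite subrr adde0.
  - exact: cM.
  - exact: cM.
  - by move=> b b01; exact: M0.
  - by move=> b b01; exact: M0.
  - move=> b b01; have := d r.+1 k.+1 b b01; move: b01; rewrite in_itv/= => /andP[b0 _].
    move/is_derive_eq; apply; rewrite /= (exprS b).
    by move: (_ ^+ r) (_ ^+ r.+1) (b ^+ k) => e f g; field; rewrite gt_eqF.
  - exact: lim0.
  - exact: Phi1.
(* Cancelling k+1 this way is valid for infinite y too, so finiteness of the integral need not be
   known. *)
have cVK (y : \bar R) : y = ((k.+1%:R^-1)%:E * (k.+1%:R%:E * y))%E.
  by rewrite muleA -EFinM mulVf// mul1e.
rewrite [LHS]cVK h -EFinM; congr EFin.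
rewrite factS natrM (exprS _ r.+1); field.
by rewrite nat1r expf_neq0 ?pnatr_eq0.
Unshelve. all: end_near. Qed.

(** * The substitution p = t1 / (1 - (1 - t1)^2 b) *)

Lemma nneseries_cvg {R : realType} (u : R^nat) (l : R) :
  (\sum_(0 <= k < n) u k) @[n --> \oo] --> l ->
  (\sum_(k <oo) (u k)%:E = l%:E)%E.
Proof.
move=> ul; apply/cvg_lim => //.
under eq_fun do rewrite sumEFin.
by apply: cvg_EFin; [exact: nearW|exact: ul].
Qed.

(** The variable p as a function of x = t1 for fixed b; there t2 = 1 - (1 - x) b. *)
Definition bphi {R : realType} (b x : R) : R := x / (1 - (1 - x) ^+ 2 * b).

Definition dbphi {R : realType} (b x : R) : R :=
  (1 - 2 * (1 - x) * b + (1 - x) ^+ 2 * b) / (1 - (1 - x) ^+ 2 * b) ^+ 2.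

Section bphi.
Context {R : realType} (b : R).
Hypothesis b01 : b \in `]0, 1[.

Let b0 : 0 < b. Proof. by move: b01; rewrite in_itv/= => /andP[]. Qed.
Let b1 : b < 1. Proof. by move: b01; rewrite in_itv/= => /andP[]. Qed.

Lemma bphi_den_gt0 (x : R) : 0 <= x <= 1 -> 0 < 1 - (1 - x) ^+ 2 * b.
Proof.
move=> /andP[x0 x1].
have h : (1 - x) ^+ 2 * b <= b.
  by rewrite ler_piMl ?(ltW b0)// exprn_ile1 ?subr_ge0 ?gerBl.
by rewrite subr_gt0 (le_lt_trans h).
Qed.

Lemma bphi_t2_gt0 (x : R) : 0 <= x <= 1 -> 0 < 1 - (1 - x) * b.
Proof.
move=> /andP[x0 x1]; have h : (1 - x) * b <= b by rewrite ler_piMl ?(ltW b0) ?gerBl.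
by rewrite subr_gt0 (le_lt_trans h).
Qed.

Lemma onem_bphi (x : R) : 0 <= x <= 1 ->
  1 - bphi b x = (1 - x) * (1 - (1 - x) * b) / (1 - (1 - x) ^+ 2 * b).
Proof.
by move=> /bphi_den_gt0 q0; rewrite /bphi; field; rewrite gt_eqF.
Qed.

Lemma bphi_in01 (x : R) : x \in `]0, 1[ -> bphi b x \in `]0, 1[.
Proof.
rewrite !in_itv/= => /andP[x0 x1].
have x01 : 0 <= x <= 1 by rewrite !ltW.
rewrite divr_gt0 ?bphi_den_gt0//= -subr_gt0 onem_bphi//.
by rewrite divr_gt0 ?bphi_den_gt0// mulr_gt0 ?bphi_t2_gt0// subr_gt0.
Qed.

Lemma bphi_homo : {in `]0, 1[ &, {homo bphi b : x y / x < y}}.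
Proof.
move=> x y; rewrite !in_itv/= => /andP[x0 x1] /andP[y0 y1] xy.
have qx : 0 < 1 - (1 - x) ^+ 2 * b by rewrite bphi_den_gt0// !ltW.
have qy : 0 < 1 - (1 - y) ^+ 2 * b by rewrite bphi_den_gt0// !ltW.
rewrite /bphi ltr_pdivrMr// mulrAC ltr_pdivlMr// -subr_gt0.
rewrite (_ : _ - _ = (y - x) * (1 - b * (1 - x * y))); last by ring.
rewrite mulr_gt0 ?subr_gt0//.
have xy0 : 0 < x * y by rewrite mulr_gt0.
have h : b * (1 - x * y) <= b by rewrite ler_piMr ?(ltW b0) ?gerBl ?(ltW xy0).
by rewrite (le_lt_trans h).
Qed.

Lemma is_derive_bphi (x : R) : 0 <= x <= 1 -> is_derive x 1 (bphi b) (dbphi b x).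
Proof.
move=> x01; have q0 := bphi_den_gt0 x01.
have d2 : is_derive x 1 (fun y : R => 1 - (1 - y) ^+ 2 * b) (2 * (1 - x) * b).
  have := is_derive1B (is_derive_cst (1:R) x 1)
    (is_derive1M (is_derive1X 2 (is_derive_onem x)) (is_derive_cst (b:R) x 1)).
  by move/is_derive_eq; apply; rewrite /= expr1; ring.
have dV : is_derive x 1 (fun y : R => (1 - (1 - y) ^+ 2 * b)^-1)
    (- (1 - (1 - x) ^+ 2 * b) ^- 2 * (2 * (1 - x) * b)).
  by apply: is_deriveV => //; rewrite gt_eqF.
have := is_derive1M (is_derive_id x 1) dV.
move/is_derive_eq; apply; rewrite /dbphi; field.
by rewrite gt_eqF.
Qed.

Lemma continuous_dbphi (x : R) : 0 <= x <= 1 -> {for x, continuous (dbphi b)}.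
Proof.
move=> x01; have q0 := bphi_den_gt0 x01.
have c1 : {for x, continuous (fun y : R => 1 - y)} by exact: is_derive1_continuous (is_derive_onem x).
have cX : {for x, continuous (fun y : R => (1 - y) ^+ 2 * b)}.
  by apply: is_derive1_continuous (is_derive1M (is_derive1X 2 (is_derive_onem x)) (is_derive_cst (b:R) x 1)).
have cq : {for x, continuous (fun y : R => 1 - (1 - y) ^+ 2 * b)}.
  by apply: cvgB; [exact: cvg_cst|exact: cX].
apply: cvgM.
  apply: cvgD; last exact: cX.
  apply: cvgB; first exact: cvg_cst.
  apply: cvgM; last exact: cvg_cst.
  by apply: cvgM; [exact: cvg_cst|exact: c1].
apply: cvgV; first by rewrite expf_neq0// gt_eqF.
by apply: (@continuous_comp _ _ _ (fun y : R => 1 - (1 - y) ^+ 2 * b) (fun y => y ^+ 2) x cq);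
  exact: exprn_continuous.
Qed.

(** With a = 1 - x the numerator is (1 - a b)^2 + a^2 b (1 - b). *)
Lemma dbphi_ge0 (x : R) : 0 <= x <= 1 -> 0 <= dbphi b x.
Proof.
move=> x01; have q0 := bphi_den_gt0 x01; rewrite divr_ge0 ?sqr_ge0//.
have : (1 - x) ^+ 2 * b ^+ 2 <= (1 - x) ^+ 2 * b.
  by rewrite ler_wpM2l ?sqr_ge0// expr2 ler_piMr// ltW.
have := sqr_ge0 (1 - (1 - x) * b).
by rewrite !expr2; nra.
Qed.

Lemma logit_bphi (x : R) : x \in `]0, 1[ ->
  logit (bphi b x) = ln (1 / (1 - x)) - ln ((1 - (1 - x) * b) / x).
Proof.
rewrite in_itv/= => /andP[x0 x1]; have x01 : 0 <= x <= 1 by rewrite !ltW.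
have a0 : 0 < 1 - x by rewrite subr_gt0.
have q0 := bphi_den_gt0 x01; have t0 := bphi_t2_gt0 x01.
rewrite /logit onem_bphi// /bphi !ln_div ?posrE ?mulr_gt0//.
by rewrite lnM ?posrE// ln1; ring.
Qed.

(** Expands 1 / t2 as the Jacobian times a power series in b p (1 - p). With u = (1 - x) b p and q
    the denominator of [bphi], 1 - u = t2 / q and 1 - 2u is the numerator of [dbphi] over q, so
    everything but 1 / t2 cancels. *)
Lemma bphi_series (x : R) : x \in `]0, 1[ ->
  (\sum_(0 <= k < n) cbin k.+1 / 2 * b ^+ k * pq (bphi b x) ^+ k * dbphi b x)
    @[n --> \oo] --> (1 - (1 - x) * b)^-1.
Proof.
rewrite in_itv/= => /andP[x0 x1]; have x01 : 0 <= x <= 1 by rewrite !ltW.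
have a0 : 0 < 1 - x by rewrite subr_gt0.
have q0 := bphi_den_gt0 x01; have t0 := bphi_t2_gt0 x01.
pose u := (1 - x) * b * bphi b x.
have uE : 1 - u = (1 - (1 - x) * b) / (1 - (1 - x) ^+ 2 * b).
  by rewrite /u /bphi; field; rewrite gt_eqF.
have u2E : 1 - 2 * u = (1 - 2 * (1 - x) * b + (1 - x) ^+ 2 * b) / (1 - (1 - x) ^+ 2 * b).
  by rewrite /u /bphi; field; rewrite gt_eqF.
have n0 : 0 < 1 - 2 * (1 - x) * b + (1 - x) ^+ 2 * b.
  have : 0 < (1 - x) ^+ 2 * b * (1 - b).
    by rewrite !mulr_gt0 ?exprn_gt0// subr_gt0.
  have := sqr_ge0 (1 - (1 - x) * b).
  by rewrite !expr2; nra.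
have u0 : 0 < u by rewrite !mulr_gt0// invr_gt0.
have u1 : 2 * u < 1 by rewrite -subr_gt0 u2E divr_gt0.
have pqu : pq u = b * pq (bphi b x).
  by rewrite /pq onem_bphi// uE /u /bphi; field; rewrite gt_eqF.
rewrite (_ : (fun _ => _) = (fun n => (\sum_(0 <= k < n) cbin k.+1 / 2 * pq u ^+ k) * dbphi b x)); last first.
  apply/funext => n; rewrite mulr_suml; apply: eq_bigr => k _.
  by rewrite pqu [(b * _) ^+ _]exprMn !mulrA.
rewrite (_ : (1 - (1 - x) * b)^-1 = ((1 - 2 * u) * (1 - u))^-1 * dbphi b x); last first.
  by rewrite u2E uE /dbphi; field; rewrite !gt_eqF.
by apply: cvgM; [exact: cvg_cbin_series_shift|exact: cvg_cst].
Qed.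

Lemma integral_bphi (h : R -> R) : continuous h -> (forall y, 0 <= h y) ->
  (\int[lebesgue_measure]_(x in `]0%R, 1%R[)
    (h (ln (1 / (1 - x)) - ln ((1 - (1 - x) * b) / x)) / (1 - (1 - x) * b))%:E =
  \sum_(k <oo) (cbin k.+1 / 2 * b ^+ k : R)%:E *
    \int[lebesgue_measure]_(p in `]0%R, 1%R[) (h (logit p) * pq p ^+ k)%:E)%E.
Proof.
move=> ch h0.
have in01 (x : R) : x \in `]0, 1[ -> 0 <= x <= 1.
  by rewrite in_itv/= => /andP[? ?]; rewrite !ltW.
have cG k : {in `]0, 1[, continuous (fun p : R => h (logit p) * pq p ^+ k)}.
  move=> p p01; apply: cvgM.
    apply: (@continuous_comp _ _ _ logit h); last exact: ch.
    exact: is_derive1_continuous (is_derive_logit p01).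
  exact: is_derive1_continuous (is_derive1X k (is_derive_pq p)).
have G0 k : {in `]0, 1[, forall p : R, 0 <= h (logit p) * pq p ^+ k}.
  by move=> p p01; rewrite mulr_ge0// exprn_ge0// ltW// pq_gt0.
have cGF k : {in `]0, 1[, continuous (fun x : R => h (logit (bphi b x)) * pq (bphi b x) ^+ k * dbphi b x)}.
  move=> x x01; apply: cvgM; last exact: continuous_dbphi (in01 _ x01).
  apply: (@continuous_comp _ _ _ (bphi b) (fun p => h (logit p) * pq p ^+ k)).
    exact: is_derive1_continuous (is_derive_bphi (in01 _ x01)).
  exact/cG/bphi_in01.
have c0 k : 0 <= cbin k.+1 / 2 * b ^+ k :> R.
  by rewrite mulr_ge0 ?exprn_ge0 ?(ltW b0)// divr_ge0// ltW// cbin_gt0.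
have step k : ((cbin k.+1 / 2 * b ^+ k : R)%:E *
    \int[lebesgue_measure]_(p in `]0%R, 1%R[) (h (logit p) * pq p ^+ k)%:E =
    \int[lebesgue_measure]_(x in `]0%R, 1%R[)
      (h (logit (bphi b x)) * (cbin k.+1 / 2 * b ^+ k * pq (bphi b x) ^+ k * dbphi b x))%:E)%E.
  rewrite (@ge0_integration_by_substitution_oo R (bphi b) (dbphi b) _ 0 1 0 1 ltr01).
  - rewrite -ge0_integralZl_EFin//.
    + by apply: eq_integral => x _; rewrite -EFinM; congr EFin; ring.
    + move=> x x01; rewrite lee_fin mulr_ge0 ?dbphi_ge0 ?in01//.
      exact/G0/bphi_in01.
    + apply/measurable_EFinP; exact: (measurable_fun_continuous_oo (cGF k)).
  - exact: bphi_homo.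
  - exact: bphi_in01.
  - by move=> x /in01; exact: is_derive_bphi.
  - by move=> x /in01; exact: continuous_dbphi.
  - by move=> x /in01; exact: dbphi_ge0.
  - rewrite -[X in _ --> X](_ : bphi b 0 = 0); last by rewrite /bphi mul0r.
    apply/cvg_at_right_filter/is_derive1_continuous/is_derive_bphi.
    by rewrite lexx ler01.
  - rewrite -[X in _ --> X](_ : bphi b 1 = 1); last by rewrite /bphi subrr expr0n/= mul0r subr0 divr1.
    apply/cvg_at_left_filter/is_derive1_continuous/is_derive_bphi.
    by rewrite lexx ler01.
  - exact: cG.
  - exact: G0.
under eq_eseriesr do rewrite step.
rewrite -integral_nneseries//.
- apply: eq_integral => x; rewrite inE/= => x01.
  apply/esym/nneseries_cvg.
  rewrite -logit_bphi//.
  under eq_fun do rewrite -mulr_sumr.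
  by apply: cvgM; [exact: cvg_cst|exact: bphi_series].
- move=> k; apply/measurable_EFinP.
  apply: (measurable_fun_continuous_oo (_ : {in _, continuous _})) => x x01.
  rewrite (_ : (fun _ => _) = fun x : R => (cbin k.+1 / 2 * b ^+ k) *
     (h (logit (bphi b x)) * pq (bphi b x) ^+ k * dbphi b x)); last by apply/funext => y; ring.
  by apply: cvgM; [exact: cvg_cst|exact: cGF].
- move=> k x x01; rewrite lee_fin mulr_ge0//; apply: mulr_ge0; last exact/dbphi_ge0/in01.
  by rewrite mulr_ge0// exprn_ge0// ltW// pq_gt0// bphi_in01.
Qed.

End bphi.

(** * Reduction of the double integral *)

(** Since the inverse of 0 is 0 here, inversion is the extension by zero of a continuous function on
    an open set. *)
Lemma measurable_inv {R : realType} : measurable_fun [set: R] (fun x : R => x^-1).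
Proof.
have oD : open [set x : R | x != 0] by exact: open_neq.
rewrite (_ : (fun x : R => x^-1) = (fun x : R => x^-1) \_ [set x | x != 0]).
  apply/(measurable_restrictT _ (open_measurable oD)).
  apply: open_continuous_measurable_fun => // x.
  by rewrite inE; exact: inv_continuous.
apply/funext => x; rewrite patchE; case: ifPn => //.
by rewrite notin_setE/= => /negP/negPn/eqP ->; rewrite invr0.
Qed.

Section tonelli.
Context {R : realType} (r : nat) (h : R -> R).
Hypotheses (ch : continuous h) (h0 : forall y, 0 <= h y).

Definition hintegrand (t : R * R) : R :=
  ln ((1 - t.1) / (1 - t.2)) ^+ r * h (ln (1 / (1 - t.1)) - ln (t.2 / t.1))
  / ((1 - t.1) * t.2).

(** Here [t.2] is no longer t2 but s = 1 - b, where t2 = t1 + (1 - t1) s; the Jacobian 1 - t1 has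
    cancelled the factor 1 / (1 - t1). *)
Definition squareint (t : R * R) : R :=
  (- ln (1 - t.2)) ^+ r * (h (ln (1 / (1 - t.1)) - ln ((1 - (1 - t.1) * (1 - t.2)) / t.1))
  / (1 - (1 - t.1) * (1 - t.2))).

Let square : set (R * R) := `]0, 1[%classic `*` `]0, 1[%classic.

Let m1 : measurable_fun [set: R * R] (fun t : R * R => 1 - t.1).
Proof. by apply: measurable_funB => //; exact: measurable_fst. Qed.
Let m2 : measurable_fun [set: R * R] (fun t : R * R => 1 - t.2).
Proof. by apply: measurable_funB => //; exact: measurable_snd. Qed.
Let mV (f : R * R -> R) : measurable_fun setT f -> measurable_fun setT (fun t => (f t)^-1).
Proof. by move=> mf; apply: measurableT_comp mf; exact: measurable_inv. Qed.
Let mln (f : R * R -> R) : measurable_fun setT f -> measurable_fun setT (fun t => ln (f t)).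
Proof. by move=> mf; apply: measurableT_comp mf; exact: measurable_ln. Qed.
Let mh (f : R * R -> R) : measurable_fun setT f -> measurable_fun setT (fun t => h (f t)).
Proof. by move=> mf; apply: measurableT_comp mf; exact: continuous_measurable_fun. Qed.

Lemma measurable_hintegrand : measurable_fun setT hintegrand.
Proof.
apply: measurable_funM; last first.
  by apply: mV; apply: measurable_funM => //; exact: measurable_snd.
apply: measurable_funM.
  by apply: measurable_funX; apply: mln; apply: measurable_funM => //; exact: mV.
apply: mh; apply: measurable_funB; apply: mln; apply: measurable_funM => //.
- exact: mV.
- by apply: mV; exact: measurable_fst.
Qed.

Let measurable_squareint_factor : measurable_fun setT (fun t : R * R =>
  h (ln (1 / (1 - t.1)) - ln ((1 - (1 - t.1) * (1 - t.2)) / t.1)) / (1 - (1 - t.1) * (1 - t.2))).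
Proof.
have mt : measurable_fun setT (fun t : R * R => 1 - (1 - t.1) * (1 - t.2)).
  by apply: measurable_funB => //; exact: measurable_funM.
apply: measurable_funM; last exact: mV.
apply: mh; apply: measurable_funB; apply: mln; apply: measurable_funM => //.
  exact: mV.
by apply: mV; exact: measurable_fst.
Qed.

Lemma measurable_squareint : measurable_fun setT squareint.
Proof.
apply: measurable_funM; last exact: measurable_squareint_factor.
by apply: measurable_funX; apply: measurable_funN; exact: mln.
Qed.

Lemma measurable_E2 : measurable (@E2 R).
Proof.
have lt2 (f g : R * R -> R) : measurable_fun setT f -> measurable_fun setT g ->
    measurable [set t | f t < g t].
  move=> mf mg; have := measurable_fun_ltr mf mg.
  by move=> /(_ measurableT [set true]); rewrite setTI; exact.
rewrite (_ : E2 = [set t : R * R | 0 < t.1] `&` ([set t | t.1 < t.2] `&` [set t | t.2 < 1])) //.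
by apply: measurableI; [|apply: measurableI]; apply: lt2 => //;
  (exact: measurable_fst || exact: measurable_snd).
Qed.

Let measurable_square : measurable square.
Proof. exact: measurableX. Qed.

Lemma hintegrand_ge0 t : E2 t -> 0 <= hintegrand t.
Proof.
move=> [t0 [t12 t1]]; rewrite /hintegrand.
have a0 : 0 < 1 - t.1 by rewrite subr_gt0 (lt_trans t12).
have c0 : 0 < 1 - t.2 by rewrite subr_gt0.
apply: divr_ge0; last by rewrite ltW// mulr_gt0// (lt_trans t0).
apply: mulr_ge0 => //; apply: exprn_ge0.
by rewrite ln_ge0// ler_pdivlMr// mul1r; lra.
Qed.

Lemma squareint_ge0 t : square t -> 0 <= squareint t.
Proof.
move=> [/= + +]; rewrite !in_itv/= => /andP[t1 t1'] /andP[t2 t2']; rewrite /squareint.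
have t01 : 1 - t.2 \in `]0, 1[ by rewrite in_itv/=; apply/andP; split; lra.
apply: mulr_ge0; last by rewrite divr_ge0// ltW// bphi_t2_gt0// !ltW.
by apply: exprn_ge0; rewrite oppr_ge0 ln_le0// gerBl ltW.
Qed.

Let slice (x : R) : x \in `]0, 1[ ->
  (\int[lebesgue_measure]_(y in `]x, 1%R[) (hintegrand (x, y))%:E =
   \int[lebesgue_measure]_(s in `]0%R, 1%R[) (squareint (x, s))%:E)%E.
Proof.
rewrite in_itv/= => /andP[x0 x1]; have a0 : 0 < 1 - x by rewrite subr_gt0.
have yx1 (y : R) : y \in `]x, 1[ -> [/\ 0 < 1 - y, 0 < y & x < y].
  by rewrite in_itv/= => /andP[xy y1]; split; lra.
have dF (s : R) : is_derive s 1 (fun s : R => x + (1 - x) * s) (1 - x).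
  have := is_deriveD (is_derive_cst (x : R) s 1)
    (is_derive1M (is_derive_cst (1 - x : R) s 1) (is_derive_id s 1)).
  by move/is_derive_eq; apply; rewrite /=; ring.
rewrite (@ge0_integration_by_substitution_oo R (fun s => x + (1 - x) * s) (fun=> 1 - x)
  (fun y => hintegrand (x, y)) 0 1 x 1 ltr01).
- apply: eq_integral => s; rewrite inE/= in_itv/= => /andP[s0 s1]; congr EFin.
  have c0 : 0 < 1 - s by rewrite subr_gt0.
  rewrite /hintegrand /squareint /=.
  have -> : x + (1 - x) * s = 1 - (1 - x) * (1 - s) by ring.
  have -> : (1 - x) / (1 - (1 - (1 - x) * (1 - s))) = (1 - s)^-1.
    by rewrite subKr; field; rewrite !gt_eqF.
  rewrite lnV ?posrE//; move: (h _) => H.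
  have q0 : 0 < 1 - (1 - x) * (1 - s).
    have -> : 1 - (1 - x) * (1 - s) = x + (1 - x) * s by ring.
    by rewrite addr_gt0// mulr_gt0.
  by move: (_ ^+ r) => e; field; rewrite !gt_eqF.
- move=> s s' _ _ ss'; by rewrite ltrD2l ltr_pM2l.
- move=> s; rewrite !in_itv/= => /andP[s0 s1]; rewrite ltrDl mulr_gt0//=.
  by rewrite -ltrBrDl gtr_pMr.
- by move=> s _; exact: dF.
- by move=> s _; exact: cvg_cst.
- by move=> s _; exact: ltW.
- rewrite -[X in _ --> X](_ : x + (1 - x) * 0 = x); last by rewrite mulr0 addr0.
  by apply: cvg_at_right_filter; exact: is_derive1_continuous (dF 0).
- rewrite -[X in _ --> X](_ : x + (1 - x) * 1 = 1); last by rewrite mulr1 subrKC.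
  by apply: cvg_at_left_filter; exact: is_derive1_continuous (dF 1).
- move=> y /yx1[y1 y0 xy].
  have cid : {for y, continuous (fun y : R => y)} by exact: cvg_id.
  have clnl : {for y, continuous (fun y : R => ln ((1 - x) / (1 - y)))}.
    apply: (@continuous_comp _ _ _ (fun y : R => (1 - x) / (1 - y)) (@ln R)).
      apply: cvgM; first exact: cvg_cst.
      apply: cvgV; first by rewrite gt_eqF.
      by apply: cvgB; [exact: cvg_cst|exact: cid].
    by apply: continuous_ln; rewrite divr_gt0.
  suff : {for y, continuous (fun y : R => ln ((1 - x) / (1 - y)) ^+ r *
      h (ln (1 / (1 - x)) - ln (y / x)) / ((1 - x) * y))} by [].
  apply: cvgM; last first.
    apply: cvgV; first by rewrite gt_eqF// mulr_gt0.
    by apply: cvgM; [exact: cvg_cst|exact: cid].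
  apply: cvgM.
    apply: (@continuous_comp _ _ _ (fun y : R => ln ((1 - x) / (1 - y))) (fun z => z ^+ r)) => //.
    exact: exprn_continuous.
  apply: (@continuous_comp _ _ _ (fun y : R => ln (1 / (1 - x)) - ln (y / x)) h); last exact: ch.
  apply: cvgB; first exact: cvg_cst.
  apply: (@continuous_comp _ _ _ (fun y : R => y / x) (@ln R)).
    by apply: cvgM; [exact: cid|exact: cvg_cst].
  by apply: continuous_ln; rewrite divr_gt0.
- move=> y /yx1[y1 y0 xy]; apply: hintegrand_ge0; split => //=; split => //.
  by rewrite -subr_gt0.
Qed.

(** Both integrands are extended by zero to the plane. Tonelli is used twice: to slice at fixed t1,
    where s replaces t2, and to put the t1-integral inside, where s, hence b, is fixed. *)
Lemma integral_E2_square :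
  (\int[lebesgue_measure \x lebesgue_measure]_(t in E2) (hintegrand t)%:E =
   \int[lebesgue_measure]_(s in `]0%R, 1%R[)
     \int[lebesgue_measure]_(x in `]0%R, 1%R[) (squareint (x, s))%:E)%E.
Proof.
pose f : R * R -> \bar R := (EFin \o hintegrand) \_ E2.
pose g : R * R -> \bar R := (EFin \o squareint) \_ square.
have mf : measurable_fun setT f.
  apply/(measurable_restrictT _ measurable_E2)/measurable_funTS.
  by apply/measurable_EFinP; exact: measurable_hintegrand.
have mg : measurable_fun setT g.
  apply/(measurable_restrictT _ measurable_square)/measurable_funTS.
  by apply/measurable_EFinP; exact: measurable_squareint.
have f0 t : (0 <= f t)%E.
  by rewrite /f patchE; case: ifPn => // /set_mem tE; rewrite lee_fin hintegrand_ge0.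
have g0 t : (0 <= g t)%E.
  by rewrite /g patchE; case: ifPn => // /set_mem tS; rewrite lee_fin squareint_ge0.
rewrite integral_mkcond -/f fubini_tonelli1//.
transitivity (\int[lebesgue_measure]_x \int[lebesgue_measure]_y g (x, y))%E.
  apply: eq_integral => x _; rewrite /fubini_F.
  have [x01|x01] := boolP (x \in `]0, 1[).
    transitivity (\int[lebesgue_measure]_(y in `]x, 1%R[) (hintegrand (x, y))%:E)%E.
      rewrite [RHS]integral_mkcond; apply: eq_integral => y _.
      rewrite /f !patchE; congr (if _ then _ else _).
      apply/idP/idP; rewrite !inE /E2 /= in_itv/=; move: x01; rewrite in_itv/= => /andP[x0 x1].
        by move=> [_ [-> ->]].
      by move=> /andP[? ?].
    rewrite slice// [LHS]integral_mkcond; apply: eq_integral => s _.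
    rewrite /g !patchE; congr (if _ then _ else _).
    by apply/idP/idP; rewrite !inE /square /=; [move=> ?; split|case].
  rewrite !integral0_eq// => y _.
    rewrite /g patchE ifF//; apply/negbTE/negP => /set_mem[/= x01'].
    by rewrite x01' in x01.
  rewrite /f patchE ifF//; apply/negbTE/negP => /set_mem[/= x0 [xy y1]].
  by move: x01; rewrite in_itv/= x0 (lt_trans xy y1).
rewrite fubini_tonelli// [RHS]integral_mkcond; apply: eq_integral => s _.
rewrite patchE; case: ifPn => s01.
  rewrite [RHS]integral_mkcond; apply: eq_integral => x _.
  rewrite /g !patchE; congr (if _ then _ else _).
  by apply/idP/idP; rewrite !inE /square /=; [case|move=> ?; split => //; move/set_mem: s01].
apply: integral0_eq => x _; rewrite /g patchE ifF//.
by apply/negbTE/negP => /set_mem[/= _ s01']; move/negP: s01; apply; rewrite inE.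
Qed.

Lemma integral_E2_series :
  (\int[lebesgue_measure \x lebesgue_measure]_(t in E2) (hintegrand t)%:E =
   \sum_(k <oo) (cbin k.+1 / 2 * (r`!%:R / k.+1%:R ^+ r.+1) : R)%:E *
     \int[lebesgue_measure]_(p in `]0%R, 1%R[) (h (logit p) * pq p ^+ k)%:E)%E.
Proof.
rewrite integral_E2_square.
pose A k := (\int[lebesgue_measure]_(p in `]0%R, 1%R[) (h (logit p) * pq p ^+ k)%:E)%E.
have A0 k : (0 <= A k)%E.
  apply: integral_ge0 => p p01; rewrite lee_fin mulr_ge0// exprn_ge0// ltW//.
  exact: pq_gt0.
have c0 k : 0 <= cbin k.+1 / 2 :> R by rewrite divr_ge0// ltW// cbin_gt0.
pose B (k : nat) (s : R) : R := (- ln (1 - s)) ^+ r * (1 - s) ^+ k.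
have in01 (s : R) : s \in `]0, 1[ -> 1 - s \in `]0, 1[.
  by rewrite !in_itv/= => /andP[? ?]; apply/andP; split; lra.
have ln0 (s : R) : s \in `]0, 1[ -> 0 <= - ln s.
  by rewrite in_itv/= => /andP[s0 s1]; rewrite oppr_ge0 ln_le0// ltW.
have B0 k (s : R) : s \in `]0, 1[ -> 0 <= B k s.
  move=> /in01 s01; rewrite mulr_ge0 ?exprn_ge0 ?ln0//.
  by move: s01; rewrite in_itv/= => /andP[/ltW].
have cB0 k : {in `]0, 1[, continuous (fun b : R => (- ln b) ^+ r * b ^+ k)}.
  move=> b; rewrite in_itv/= => /andP[b0 _].
  exact: is_derive1_continuous (is_derive1M (is_derive1X r (is_deriveN (is_derive1_ln b0)))
    (is_derive1X k (is_derive_id b 1))).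
have cB k : {in `]0, 1[, continuous (B k)}.
  move=> s s01; apply: (@continuous_comp _ _ _ (fun s : R => 1 - s) (fun b : R => (- ln b) ^+ r * b ^+ k)).
    exact: is_derive1_continuous (is_derive_onem s).
  exact/cB0/in01.
have mB k : measurable_fun (`]0, 1[ : set R) (fun s => (B k s)%:E).
  by apply/measurable_EFinP; exact: (measurable_fun_continuous_oo (cB k)).
have IB k : (\int[lebesgue_measure]_(s in `]0%R, 1%R[) (B k s)%:E =
    (r`!%:R / k.+1%:R ^+ r.+1 : R)%:E)%E.
  rewrite -integral_lnN_exp [RHS]ge0_integral_onem//.
  by move=> b b01; rewrite mulr_ge0 ?exprn_ge0 ?ln0//; move: b01; rewrite in_itv/= => /andP[/ltW].
transitivity (\int[lebesgue_measure]_(s in `]0%R, 1%R[)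
    \sum_(k <oo) ((cbin k.+1 / 2)%:E * A k * (B k s)%:E))%E.
  apply: eq_integral => s; rewrite inE/= => s01.
  have s01' := in01 _ s01.
  have P0 : 0 <= (- ln (1 - s)) ^+ r by rewrite exprn_ge0// ln0.
  under eq_integral do rewrite /squareint /= EFinM.
  rewrite ge0_integralZl_EFin//; last 2 first.
  - move=> x x01; rewrite lee_fin divr_ge0// ltW// bphi_t2_gt0//.
    by move: x01; rewrite /= in_itv/= => /andP[? ?]; rewrite !ltW.
  - apply/measurable_EFinP/measurable_funTS.
    exact: (measurable_fun_pair1 _ measurable_squareint_factor).
  rewrite /= (integral_bphi s01')// -nneseriesZl//.
    apply: eq_eseriesr => k _; rewrite /B -/(A k).
    rewrite [in RHS]muleAC muleA -!EFinM; congr (_%:E * _)%E; ring.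
  move=> k _; apply: mule_ge0; last exact: A0.
  rewrite lee_fin mulr_ge0// exprn_ge0//.
  by move: s01'; rewrite in_itv/= => /andP[/ltW].
rewrite integral_nneseries//.
- apply: eq_eseriesr => k _; rewrite ge0_integralZl//.
  + by rewrite IB muleAC -EFinM.
  + exact: mB.
  + by move=> s s01; rewrite lee_fin B0.
  + by apply: mule_ge0; rewrite ?lee_fin.
- by move=> k; apply: emeasurable_funM; [exact: measurable_cst|exact: mB].
- move=> k s s01; apply: mule_ge0; last by rewrite lee_fin B0.
  by apply: mule_ge0; rewrite ?lee_fin.
Qed.

End tonelli.

(** * Evaluation *)

Lemma integral_E2_even {R : realType} (r m : nat) :
  (\int[lebesgue_measure \x lebesgue_measure]_(t in E2)
    (hintegrand r (fun y : R => y ^+ m.*2) t)%:E =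
  (r`!%:R * (m.*2)`!%:R * zeta_star (r.+2 :: nseq m 2%N))%:E)%E.
Proof.
rewrite integral_E2_series; last 2 first.
- by move=> y; exact: exprn_continuous.
- by move=> y; rewrite exprn_even_ge0 ?odd_double.
under eq_eseriesr do rewrite -/(moment _ _) rmomentE -EFinM.
apply: nneseries_cvg.
rewrite (_ : (fun _ => _) = fun n => r`!%:R * (m.*2)`!%:R *
    \sum_(1 <= k < n.+1) k%:R ^- r.+2 * nmoment m k); last first.
  (* One factor k+1 and the coefficient [cbin k.+1 / 2] are the normalization inside
     [nmoment m k.+1]; this raises the exponent from r+1 to r+2. *)
  apply/funext => n; rewrite big_add1 /= mulr_sumr; apply: eq_bigr => k _.
  rewrite /nmoment (exprS _ r.+1) /=; field.
  by rewrite nat1r expf_neq0 ?pnatr_eq0 -?lt0n ?fact_gt0.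
apply: cvgM; first exact: cvg_cst.
apply: cvg_zeta_star.
- by move=> m' k; exact: nmoment_ge0.
- exact: nmoment0.
- by move=> m' k; exact: nmomentS.
- exact: cvg_nmoment.
Qed.

Lemma integrable_hintegrand_even {R : realType} (r m : nat) :
  (lebesgue_measure \x lebesgue_measure)%E.-integrable (@E2 R)
    (fun t => (hintegrand r (fun y : R => y ^+ m.*2) t)%:E).
Proof.
have ch : continuous (fun y : R => y ^+ m.*2) by move=> y; exact: exprn_continuous.
apply/integrableP; split.
  by apply/measurable_EFinP/measurable_funTS; exact: measurable_hintegrand.
have abs t : t \in @E2 R -> `|(hintegrand r (fun y : R => y ^+ m.*2) t)%:E|%E =
    (hintegrand r (fun y : R => y ^+ m.*2) t)%:E.
  rewrite inE => tE; rewrite gee0_abs// lee_fin hintegrand_ge0//.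
  by move=> y; rewrite exprn_even_ge0 ?odd_double.
under eq_integral => t tE do rewrite abs//.
by rewrite integral_E2_even ltry.
Qed.

(** Domination by the sum of the even cases with exponents 0 and 2m, whose integrals are finite. *)
Lemma integrable_hintegrand {R : realType} (r m : nat) (h : R -> R) :
  continuous h -> (forall y, `|h y| <= 1 + y ^+ m.*2) ->
  (lebesgue_measure \x lebesgue_measure)%E.-integrable (@E2 R)
    (fun t => (hintegrand r h t)%:E).
Proof.
move=> ch hm.
have i0 := @integrable_hintegrand_even R r 0.
have im := @integrable_hintegrand_even R r m.
apply: (le_integrable _ _ _ (integrableD _ i0 im)); try exact: measurable_E2.
  by apply/measurable_EFinP/measurable_funTS; exact: measurable_hintegrand.
move=> t tE; rewrite /= lee_fin /hintegrand.
have := @hintegrand_ge0 R r (fun=> 1) (fun=> ler01) t tE.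
rewrite /hintegrand mulr1.
set y := ln (1 / _) - _; set W := _ ^+ r; set d := _ * t.2 => Wd.
have -> : W / d + W * y ^+ m.*2 / d = W / d * (1 + y ^+ m.*2).
  by ring.
rewrite [W * h y / d]mulrAC 2!(normrM (W / d)) (ger0_norm Wd) ler_wpM2l//.
exact: le_trans (hm y) (ler_norm _).
Qed.

Lemma integral_E2_odd {R : realType} (r n : nat) : odd n ->
  (\int[lebesgue_measure \x lebesgue_measure]_(t in E2)
    (hintegrand r (fun y : R => y ^+ n) t)%:E = 0)%E.
Proof.
move=> n_odd.
(* Positive and negative parts of y^n. As n is odd, they are mirror images of each other, so p -> 1
   - p equates their series term by term. *)
pose hp (y : R) : R := (`|y| ^+ n + y ^+ n) / 2.
pose hm (y : R) : R := (`|y| ^+ n - y ^+ n) / 2.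
have hmE y : hm y = hp (- y).
  by rewrite /hm /hp normrN (exprNn y) -signr_odd n_odd expr1 mulN1r.
have nle (y : R) : `|y ^+ n| <= `|y| ^+ n by rewrite normrX.
have hp0 y : 0 <= hp y.
  by rewrite divr_ge0//; have := nle y; rewrite ler_norml; lra.
have hm0 y : 0 <= hm y by rewrite hmE.
have cX : continuous (fun y : R => y ^+ n) by move=> y; exact: exprn_continuous.
have cN : continuous (fun y : R => `|y| ^+ n).
  move=> y; apply: (@continuous_comp _ _ _ (fun y : R => `|y|) (fun z => z ^+ n)).
    exact: norm_continuous.
  exact: exprn_continuous.
have chp : continuous hp.
  by move=> y; apply: cvgM; [apply: cvgD; [exact: cN|exact: cX]|exact: cvg_cst].
have chm : continuous hm.
  by move=> y; apply: cvgM; [apply: cvgB; [exact: cN|exact: cX]|exact: cvg_cst].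
have yle (y : R) : `|y| ^+ n <= 1 + y ^+ n.*2.
  have -> : y ^+ n.*2 = (`|y| ^+ n) ^+ 2.
    by rewrite -normrX real_normK ?num_real// -exprM muln2.
  by move: (_ ^+ n) => z; have := sqr_ge0 (z - 1); have := sqr_ge0 z; rewrite !expr2; lra.
have hple y : `|hp y| <= 1 + y ^+ n.*2.
  rewrite ger0_norm//; apply: le_trans (yle y).
  by have := nle y; rewrite /hp ler_norml; lra.
have hmle y : `|hm y| <= 1 + y ^+ n.*2.
  rewrite ger0_norm//; apply: le_trans (yle y).
  by have := nle y; rewrite /hm ler_norml; lra.
have ip := integrable_hintegrand r chp hple.
have im := integrable_hintegrand r chm hmle.
under eq_integral => t _.
  have -> : hintegrand r (fun y : R => y ^+ n) t = hintegrand r hp t - hintegrand r hm t.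
    by rewrite /hintegrand -mulrBl -mulrBr /hp /hm; congr (_ * _ / _); field.
  rewrite EFinB; over.
rewrite (integralB _ ip im); last exact: measurable_E2.
suff -> : (\int[lebesgue_measure \x lebesgue_measure]_(t in E2) (hintegrand r hm t)%:E =
    \int[lebesgue_measure \x lebesgue_measure]_(t in E2) (hintegrand r hp t)%:E)%E.
  by rewrite subee// integrable_fin_num//; exact: measurable_E2.
rewrite !integral_E2_series//; apply: eq_eseriesr => k _; congr (_ * _)%E.
rewrite ge0_integral_onem.
- apply: eq_integral => p _; rewrite logit_onem hmE opprK.
  by rewrite /pq subKr (mulrC p).
- move=> p p01; apply: cvgM.
    apply: (@continuous_comp _ _ _ logit hm); last exact: chm.
    exact: is_derive1_continuous (is_derive_logit p01).
  exact: is_derive1_continuous (is_derive1X k (is_derive_pq p)).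
- by move=> p p01; rewrite mulr_ge0// exprn_ge0// ltW// pq_gt0.
Qed.

Unset Implicit Arguments.
Set Strict Implicit.

Theorem theorem3p2 (R : realType) (n r : nat) :
  ((@lebesgue_measure R) \x (@lebesgue_measure R))%E.-integrable E2
      (fun t => (integrand3p2 r n t)%:E) /\
  ((((r`!)%:R * (n`!)%:R)^-1 : R)%:E *
     \int[((@lebesgue_measure R) \x (@lebesgue_measure R))%E]_(t in E2)
        (integrand3p2 r n t)%:E)%E
  = (if odd n then 0 else zeta_star (r.+2 :: nseq n./2 2%N))%:E.
Proof.
split.
  (* The dominating exponent is 2n, even for either parity of n. *)
  apply: (@integrable_hintegrand R r n (fun y => y ^+ n)).
    by move=> y; exact: exprn_continuous.
  move=> y; rewrite -muln2 exprM; move: (y ^+ n) => z.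
  have := sqr_ge0 (z - 1); have := sqr_ge0 (z + 1); have := sqr_ge0 z.
  by rewrite ler_norml !expr2; lra.
have [n_odd|] := boolP (odd n).
  by rewrite (integral_E2_odd r n_odd) mule0.
rewrite -dvdn2 dvdn_eq muln2 divn2 => /eqP nE; rewrite -[in LHS]nE.
by rewrite (integral_E2_even r n./2) -EFinM mulKf// mulf_neq0 ?pnatr_eq0 -?lt0n ?fact_gt0.
Qed.
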